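(* For a Tychonoff space $X$, the following conditions are equivalent: (1) $X$ is pseudo-$\omega$-bounded; (2) $P_\beta(X)$ is pseudocompact; (3) $P_\beta(X)$ is $C^*$-embedded in $P(\beta X)$; (4) $P_\beta(X)$ is pseudo-$\omega$-bounded.
   Context: $\beta X$ is the Stone–Čech compactification of $X$. $P(\beta X)$ is the set of Radon probability measures on the Borel $\sigma$-algebra of $\beta X$, with the weak topology, i.e. the topology generated by the functions $\mu\mapsto\int f\,d\mu$ for continuous $f:\beta X\to\mathbb R$. $P_\beta(X)$ is the subspace of all $\mu\in P(\beta X)$ such that $\mu(K)=1$ for some compact set $K\subset X$. A space $Z$ is pseudo-$\omega$-bounded if for every sequence $(U_n)_n$ of nonempty open subsets of $Z$ there is a compact $K\subset Z$ with $U_n\cap K\neq\varnothing$ for all $n$. A space is pseudocompact if every continuous real-valued function on it is bounded. A subspace $Y\subset Z$ is $C^*$-embedded in $Z$ if every bounded continuous function $Y\to\mathbb R$ extends to a continuous function on $Z$. *)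

(* Defs.v *)
From HB Require Import structures.
From mathcomp Require Import all_boot all_order all_algebra.
From mathcomp Require Import all_classical all_reals all_analysis.

Set Implicit Arguments.
Unset Strict Implicit.
Unset Printing Implicit Defensive.

Import Order.TTheory GRing.Theory Num.Theory.
Import numFieldNormedType.Exports.

Local Open Scope classical_set_scope.
Local Open Scope ring_scope.

Definition tychonoff_space (X : topologicalType) : Prop :=
  completely_regular_space X /\ hausdorff_space X.

Definition pseudo_omega_bounded (Z : topologicalType) : Prop :=
  forall U : nat -> set Z, (forall n, open (U n) /\ U n !=set0) ->
  exists K : set Z, compact K /\ forall n, U n `&` K !=set0.

Definition pseudocompact (R : realType) (Z : topologicalType) : Prop :=
  forall f : Z -> R, continuous f -> bounded_fun f.

(* [set_type Y] (the coercion of [Y : set Z] to a type) carries the topology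
   induced by [Z]; [set_val] is the inclusion. *)
Definition Cstar_embedded (R : realType) (Z : topologicalType) (Y : set Z)
    : Prop :=
  forall f : Y -> R, continuous f -> bounded_fun f ->
  exists2 g : Z -> R, continuous g & forall y : Y, g (set_val y) = f y.

Section StoneCech.
Variables (R : realType) (X : topologicalType).

Definition unit_fun : Type :=
  {f : X -> R | continuous f /\ forall x, 0 <= f x <= 1}.

Definition sc_eval (x : X) : {ptws unit_fun -> R} :=
  fun f : unit_fun => proj1_sig f x.

(* The closure of the image of [X] under the evaluation map, taken in a power of
   R; as the cube of functions with values in [0, 1] is closed there, this is
   also the closure in the cube. *)
Definition stone_cech_set : set {ptws unit_fun -> R} :=
  closure (range sc_eval).

Definition stone_cech : topologicalType := stone_cech_set.

Lemma sc_eval_in (x : X) : sc_eval x \in stone_cech_set.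
Proof. by apply/mem_set/subset_closure; exists x. Qed.

Definition sc_embed (x : X) : stone_cech := SigSub (sc_eval_in x).

End StoneCech.

(* Measurable types of the library are pointed.  A space [K] with a proof that
   it is nonempty is given an arbitrarily chosen point; no choice has to be
   made, and nothing is assumed, when [K] is empty. *)
Definition pointed_space (K : topologicalType) (hK : [set: K] !=set0) : Type :=
  K.

HB.instance Definition _ (K : topologicalType) (hK : [set: K] !=set0) :=
  Topological.copy (pointed_space hK) K.
HB.instance Definition _ (K : topologicalType) (hK : [set: K] !=set0) :=
  isPointed.Build (pointed_space hK) (projT1 (cid hK)).

Definition borel_space (K : topologicalType) (hK : [set: K] !=set0) :=
  g_sigma_algebraType (@open (pointed_space hK)).

Section RadonProbability.
Variables (R : realType) (K : topologicalType).
Local Open Scope ereal_scope.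

Definition inner_regular (hK : [set: K] !=set0)
    (mu : probability (borel_space hK) R) : Prop :=
  forall A : set (borel_space hK), measurable A ->
  mu A = ereal_sup [set mu C | C in [set C : set K | compact C /\ C `<=` A]].

(* A measure of the library is a function on all subsets, constrained only on
   the measurable ones; [rp_off_borel] fixes the irrelevant values, so that two
   elements are equal as soon as they agree on the Borel sets.
   The proof [rp_nonempty] is no restriction, the total mass being 1; the space
   of Radon probability measures on an empty space is empty. *)
Record radon_probability : Type := RadonProbability {
  rp_nonempty : [set: K] !=set0;
  rp_measure :> probability (borel_space rp_nonempty) R;
  rp_inner_regular : inner_regular rp_measure;
  rp_off_borel : forall A : set (borel_space rp_nonempty),
    ~ measurable A -> rp_measure A = 0
}.

HB.instance Definition _ := gen_eqMixin radon_probability.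
HB.instance Definition _ := gen_choiceMixin radon_probability.

Definition rp_integral (f : K -> R) (mu : radon_probability) : R :=
  (\int[rp_measure mu]_x (f x))%R.

Definition radon_weak_def :=
  sup_topology (fun f : {f : K -> R | continuous f} =>
    Topological.class (initial_topology (rp_integral (proj1_sig f)))).

HB.instance Definition _ := Topological.copy radon_probability radon_weak_def.

End RadonProbability.

(* A compact subset of [X] is seen in the compactification through its image
   under the embedding, which is again compact, hence Borel. *)
Definition P_beta (R : realType) (X : topologicalType) :
    set (radon_probability R (stone_cech R X)) :=
  [set mu | exists K : set X,
     compact K /\ rp_measure mu (@sc_embed R X @` K) = 1%E].

(* Main.v *)
From HB Require Import structures.
Require Import Defs.
From mathcomp Require Import all_boot all_order all_algebra.
From mathcomp Require Import all_classical all_reals all_analysis.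
From mathcomp Require Import measurable_realfun ring lra.

(** States (positive normalized linear functionals) on the continuous functions
    of a compact Hausdorff space are Radon probability measures (Riesz), so sets
    of measures concentrated on a fixed compact set are weakly compact, and
    elements of [P_beta X] can be handled through their integrals alone.

    (1) => (4): finitely supported measures are dense, so each open set contains
    all measures with given weights and atoms in suitable open sets of [X]; a
    compact [K] meeting these countably many open sets gives the compact set of
    measures concentrated on [K].  (4) => (2) is general.

    (2) => (1) and (3) => (1): if no compact set meets all [U n], bump functions
    on the [U n] yield a continuous [h] on [P(beta X)], positive on [P_beta X]
    with infimum [0]; [1/h] is unbounded and [sin (1/h)] does not extend.

    (1) => (3): for [f] bounded continuous on [P_beta X], let [d x x'] be the
    supremum over [t], [rho] of the change of [f] when [x] is replaced by [x'] in
    [t delta_x + (1 - t) rho].  A double limit argument shows that [d] is a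
    continuous, totally bounded pseudometric.  If moving all atoms by less than
    [1/n] could always change [f] by more than [e], this would happen on a single
    compact [K]; in the limit one gets pairs of atoms at distance [0], and
    swapping these one at a time does not change [f].  Hence a partition of unity
    subordinate to small [d]-balls approximates [f] uniformly by functions of
    finitely many integrals, which are continuous on all of [P(beta X)]. *)

Set Implicit Arguments.
Unset Strict Implicit.
Unset Printing Implicit Defensive.

Import Order.TTheory GRing.Theory Num.Theory.
Import numFieldNormedType.Exports.

Local Open Scope classical_set_scope.
Local Open Scope ring_scope.

(** * Continuous real functions and states *)

Section ContinuousReal.
Variables (R : realType) (T : topologicalType).
Implicit Types f g : T -> R.

Lemma ctsD f g : continuous f -> continuous g -> continuous (fun x => f x + g x).
Proof. by move=> cf cg x; apply: cvgD; [exact: cf|exact: cg]. Qed.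

Lemma ctsN f : continuous f -> continuous (fun x => - f x).
Proof. by move=> cf x; apply: cvgN; exact: cf. Qed.

Lemma ctsB f g : continuous f -> continuous g -> continuous (fun x => f x - g x).
Proof. by move=> cf cg; apply: ctsD => //; exact: ctsN. Qed.

Lemma ctsM f g : continuous f -> continuous g -> continuous (fun x => f x * g x).
Proof. by move=> cf cg x; apply: cvgM; [exact: cf|exact: cg]. Qed.

Lemma ctsV f : continuous f -> (forall x, f x != 0) ->
  continuous (fun x => (f x)^-1).
Proof. by move=> cf f0 x; apply: cvgV; [exact: f0|exact: cf]. Qed.

Lemma ctsC (a : R) : continuous (fun _ : T => a).
Proof. by move=> x; exact: cvg_cst. Qed.

Lemma cts_norm f : continuous f -> continuous (fun x => `|f x|).
Proof. by move=> cf x; apply: cvg_norm; exact: cf. Qed.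

Lemma cts_max f g : continuous f -> continuous g ->
  continuous (fun x => Num.max (f x) (g x)).
Proof. by move=> cf cg x; apply: continuous_max; [exact: cf|exact: cg]. Qed.

Lemma cts_min f g : continuous f -> continuous g ->
  continuous (fun x => Num.min (f x) (g x)).
Proof. by move=> cf cg x; apply: continuous_min; [exact: cf|exact: cg]. Qed.

Lemma cts_sum (I : Type) (r : seq I) (F : I -> T -> R) :
  (forall i, continuous (F i)) -> continuous (fun x => \sum_(i <- r) F i x).
Proof.
move=> cF; elim: r => [|i r IH].
  rewrite (_ : (fun _ => _) = fun=> 0); first exact: ctsC.
  by apply/funext => x; rewrite big_nil.
rewrite (_ : (fun _ => _) = fun x => F i x + \sum_(j <- r) F j x).
  exact: ctsD.
by apply/funext => x; rewrite big_cons.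
Qed.

Lemma cts_open_gt f (a : R) : continuous f -> open [set x | a < f x].
Proof.
move=> cf; rewrite -[X in open X]/(f @^-1` [set y | a < y]).
by apply: open_comp => //; exact: open_gt.
Qed.

Lemma cts_open_lt f (a : R) : continuous f -> open [set x | f x < a].
Proof.
move=> cf; rewrite -[X in open X]/(f @^-1` [set y | y < a]).
by apply: open_comp => //; exact: open_lt.
Qed.

Lemma cts_closed_ge f (a : R) : continuous f -> closed [set x | a <= f x].
Proof.
move=> cf; rewrite -[X in closed X]/(f @^-1` [set y | a <= y]).
by apply: closed_comp => //; exact: closed_ge.
Qed.

Lemma compact_fun_bounded f : compact [set: T] -> continuous f ->
  exists M, forall x, `|f x| <= M.
Proof.
move=> cT cf.
have : compact (f @` setT).
  by apply: continuous_compact => //; exact: continuous_subspaceT.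
move=> /compact_bounded [M [_ /(_ (M + 1))]] H.
exists (M + 1) => x; apply: H; first by rewrite ltrDl.
by exists x.
Qed.

Lemma urysohn01 (A B : set T) : hausdorff_space T -> compact [set: T] ->
  closed A -> closed B -> A `&` B = set0 ->
  exists f : T -> R, [/\ continuous f, forall x, 0 <= f x <= 1,
    forall x, A x -> f x = 0 & forall x, B x -> f x = 1].
Proof.
move=> hT cT cA cB AB.
have /(@normal_separatorP R) := compact_normal hT cT.
move=> /(_ _ _ cA cB AB) /(@uniform_separatorP _ R) [f [cf f01 f0 f1]].
exists f; split => // x.
- by have := f01 (f x); rewrite /= in_itv; apply; exists x.
- by move=> Ax; apply: f0; exists x.
- by move=> Ax; apply: f1; exists x.
Qed.

End ContinuousReal.

(** A functional on all functions, constrained on the continuous ones only, so that integrals and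
    limits of integrals qualify as they stand. *)
Definition state (R : realType) (T : topologicalType) (L : (T -> R) -> R) :=
  [/\ forall f g : T -> R, continuous f -> continuous g ->
        L (fun x => f x + g x) = L f + L g,
      forall (a : R) (f : T -> R), continuous f -> L (fun x => a * f x) = a * L f,
      forall f : T -> R, continuous f -> (forall x, 0 <= f x) -> 0 <= L f &
      L (fun=> 1) = 1].

Section StateTheory.
Variables (R : realType) (T : topologicalType) (L : (T -> R) -> R).
Hypothesis sL : state L.
Implicit Types f g : T -> R.

Lemma stateD f g : continuous f -> continuous g ->
  L (fun x => f x + g x) = L f + L g.
Proof. by case: sL => h _ _ _; exact: h. Qed.

Lemma stateZ a f : continuous f -> L (fun x => a * f x) = a * L f.
Proof. by case: sL => _ h _ _; exact: h. Qed.

Lemma state_ge0 f : continuous f -> (forall x, 0 <= f x) -> 0 <= L f.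
Proof. by case: sL => _ _ h _; exact: h. Qed.

Lemma state_cst a : L (fun=> a) = a.
Proof.
case: sL => _ _ _ L1; rewrite -[RHS]mulr1 -L1 -stateZ; last exact: ctsC.
by congr L; apply/funext => x; rewrite mulr1.
Qed.

Lemma stateB f g : continuous f -> continuous g ->
  L (fun x => f x - g x) = L f - L g.
Proof.
move=> cf cg; rewrite -[in RHS]mulN1r -stateZ// -stateD//; last first.
  by apply: ctsM => //; exact: ctsC.
by congr L; apply/funext => x; rewrite mulN1r.
Qed.

Lemma le_state f g : continuous f -> continuous g ->
  (forall x, f x <= g x) -> L f <= L g.
Proof.
move=> cf cg fg; rewrite -subr_ge0 -stateB//; apply: state_ge0.
  exact: ctsB.
by move=> x; rewrite subr_ge0.
Qed.

Lemma state_sum (I : Type) (r : seq I) (F : I -> T -> R) :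
  (forall i, continuous (F i)) ->
  L (fun x => \sum_(i <- r) F i x) = \sum_(i <- r) L (F i).
Proof.
move=> cF; elim: r => [|i r IH].
  by under eq_fun do rewrite big_nil; rewrite state_cst big_nil.
under eq_fun do rewrite big_cons.
by rewrite stateD ?IH ?big_cons//; exact: cts_sum.
Qed.

Lemma state_dist f g e : continuous f -> continuous g ->
  (forall x, `|f x - g x| <= e) -> `|L f - L g| <= e.
Proof.
move=> cf cg fg; rewrite -stateB// ler_norml; apply/andP; split.
  rewrite -(state_cst (- e)); apply: le_state; [exact: ctsC|exact: ctsB|].
  by move=> x; have := fg x; rewrite ler_norml => /andP[].
rewrite -(state_cst e); apply: le_state; [exact: ctsB|exact: ctsC|].
by move=> x; have := fg x; rewrite ler_norml => /andP[].
Qed.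

(** On an empty space the constants [0] and [1] are the same function. The Borel space asks for such
    a proof of nonemptiness. *)
Lemma state_nonempty : [set: T] !=set0.
Proof.
apply/set0P/negP => /eqP T0.
have e : (fun _ : T => 1) = (fun _ : T => 0) :> (T -> R).
  by apply/funext => x; have : [set: T] x by []; rewrite T0.
have := state_cst 1; rewrite e state_cst => /esym/eqP.
by rewrite oner_eq0.
Qed.

End StateTheory.

(** * The Riesz representation theorem *)

Section RieszOuterMeasure.
Variables (R : realType) (T : topologicalType) (L : (T -> R) -> R).
Hypotheses (hT : hausdorff_space T) (cT : compact [set: T]) (sL : state L).
Implicit Types (f g : T -> R) (V W A B : set T).

(** The support of [f] may reach the boundary of [V]; closed supports inside [V] are regained
    through [cut]. *)
Definition below V f :=
  [/\ continuous f, forall x, 0 <= f x <= 1 & forall x, ~ V x -> f x = 0].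

Definition riesz_content V : R := sup [set L f | f in below V].
Local Notation lam := riesz_content.

Lemma below0 V : below V (fun=> 0).
Proof. by split => //; [exact: ctsC|move=> x; rewrite lexx ler01]. Qed.

Lemma below_L1 V f : below V f -> L f <= 1.
Proof.
case=> cf f01 _; rewrite -(state_cst sL 1); apply: (le_state sL) => //.
  exact: ctsC.
by move=> x; case/andP: (f01 x).
Qed.

Lemma content_has_sup V : has_sup [set L f | f in below V].
Proof.
split; first by exists (L (fun=> 0)); exists (fun=> 0) => //; exact: below0.
by exists 1 => _ [f fV <-]; exact: below_L1 fV.
Qed.

Lemma le_content V f : below V f -> L f <= lam V.
Proof.
move=> fV; apply: ub_le_sup; first by case: (content_has_sup V).
by exists f.
Qed.

Lemma content_le V c : (forall f, below V f -> L f <= c) -> lam V <= c.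
Proof.
move=> Vc; apply: ge_sup; first by case: (content_has_sup V).
by move=> _ [f fV <-]; exact: Vc.
Qed.

Lemma content_ge0 V : 0 <= lam V.
Proof.
by have := le_content (below0 V); rewrite (state_cst sL).
Qed.

Lemma content_le1 V : lam V <= 1.
Proof. by apply: content_le => f /below_L1. Qed.

Lemma content_setT : lam setT = 1.
Proof.
apply/eqP; rewrite eq_le content_le1 -{1}(state_cst sL 1); apply: le_content.
split => //; [exact: ctsC|by move=> x; rewrite lexx ler01|].
by move=> x /(_ I).
Qed.

Lemma below_sub V W f : V `<=` W -> below V f -> below W f.
Proof. by move=> VW [cf f01 f0]; split => // x nW; apply: f0 => /VW. Qed.

Lemma le_content_sub V W : V `<=` W -> lam V <= lam W.
Proof.
by move=> VW; apply: content_le => f /(below_sub VW); exact: le_content.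
Qed.

Lemma content0 : lam set0 = 0.
Proof.
apply/eqP; rewrite eq_le content_ge0 andbT; apply: content_le => f [_ _ f0].
rewrite (_ : f = fun=> 0) ?(state_cst sL)//.
by apply/funext => x; apply: f0.
Qed.

(* Subtracting [e] moves the support into the closed set [e <= f], where
   compactness and Urysohn's lemma apply. *)
Definition cut e f x := Num.max 0 (f x - e).

Lemma cut_cts e f : continuous f -> continuous (cut e f).
Proof.
move=> cf; apply: cts_max; first exact: ctsC.
by apply: ctsB => //; exact: ctsC.
Qed.

Lemma cut_ge0 e f x : 0 <= cut e f x.
Proof. by rewrite le_max lexx. Qed.

Lemma cut_le e f x : 0 <= e -> 0 <= f x -> cut e f x <= f x.
Proof. by move=> e0 f0; rewrite ge_max f0 gerBl. Qed.

Lemma cut_eq0 e f x : f x <= e -> cut e f x = 0.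
Proof. by move=> fe; apply/max_idPl; rewrite subr_le0. Qed.

Lemma L_cut f e : continuous f -> L f <= L (cut e f) + e.
Proof.
move=> cf; rewrite -{2}(state_cst sL e) -(stateD sL); last exact: ctsC.
- apply: (le_state sL) => //.
    by apply: ctsD; [exact: cut_cts|exact: ctsC].
  by move=> x; rewrite -lerBlDr le_max lexx orbT.
- exact: cut_cts.
Qed.

(** Urysohn's [g] vanishes off [V] and is [1] on the part of [e <= f] outside [W], so [g] and
    [1 - g] split [cut e f] into a function below [V] and one below [W]. *)
Lemma content_setU V W : open V -> open W -> lam (V `|` W) <= lam V + lam W.
Proof.
move=> oV oW; apply: content_le => f [cf f01 f0].
apply/ler_addgt0Pr => e e0.
pose C := [set x | e <= f x].
have [||| g [cg g01 g0 g1]] := @urysohn01 R T (~` V) (C `&` ~` W) hT cT.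
- exact: open_closedC.
- by apply: closedI; [exact: cts_closed_ge|exact: open_closedC].
- rewrite -subset0 => x [nV [Cx nW]].
  have fx : f x = 0 by apply: f0; case.
  by move: Cx; rewrite /C/= fx leNgt e0.
apply: (le_trans (L_cut e cf)); rewrite lerD2r.
have cc : continuous (cut e f) by exact: cut_cts.
have cut1 x : cut e f x <= 1.
  case/andP: (f01 x) => fx0 fx1; exact: le_trans (cut_le (ltW e0) fx0) fx1.
have -> : cut e f = fun x => g x * cut e f x + (1 - g x) * cut e f x.
  by apply/funext => x; ring.
have c1 : continuous (fun x => g x * cut e f x) by exact: ctsM.
have c2 : continuous (fun x => (1 - g x) * cut e f x).
  by apply: ctsM => //; apply: ctsB => //; exact: ctsC.
rewrite (stateD sL)//; apply: lerD; apply: le_content; split => //.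
- move=> x; case/andP: (g01 x) => ? ?; rewrite mulr_ge0 ?cut_ge0//=.
  by rewrite mulr_ile1 ?cut_ge0.
- by move=> x nV; rewrite g0// mul0r.
- move=> x; case/andP: (g01 x) => ? ?.
  rewrite mulr_ge0 ?cut_ge0 ?subr_ge0//= mulr_ile1 ?cut_ge0 ?subr_ge0//.
  by rewrite gerBl.
- move=> x nW; have [fe|fe] := leP e (f x); first by rewrite g1// subrr mul0r.
  by rewrite cut_eq0 ?mulr0// ltW.
Qed.

Lemma content_bigsetU (V : nat -> set T) n : (forall i, open (V i)) ->
  open (\big[setU/set0]_(i < n) V i) /\
  lam (\big[setU/set0]_(i < n) V i) <= \sum_(i < n) lam (V i).
Proof.
move=> oV; elim: n => [|n [IH1 IH2]].
  by rewrite !big_ord0 content0; split => //; exact: open0.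
rewrite !big_ord_recr/=; split; first exact: openU.
apply: (le_trans (content_setU IH1 (oV n))).
by rewrite lerD2r.
Qed.

(** The compact set where [e <= f] is covered by finitely many [V i], and [cut e f] vanishes off it;
    finite subadditivity then bounds [L f] up to [e]. *)
Lemma content_bigcup (V : nat -> set T) : (forall i, open (V i)) ->
  ((lam (\bigcup_i V i))%:E <= \sum_(i <oo) (lam (V i))%:E)%E.
Proof.
move=> oV; apply/lee_addgt0Pr => e e0.
suff H f : below (\bigcup_i V i) f ->
  ((L f)%:E <= \sum_(i <oo) (lam (V i))%:E + e%:E)%E.
  (* The series may diverge, and then the bound is trivial; otherwise it is a real number,
     comparable with the real supremum [lam]. *)
  have [S|S] := eqVneq (\sum_(i <oo) (lam (V i))%:E)%E +oo%E.
    by rewrite S addye// leey.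
  have Sfin : (\sum_(i <oo) (lam (V i))%:E)%E \is a fin_num.
    rewrite ge0_fin_numE ?ltey//.
    by apply: nneseries_ge0 => n _ _; rewrite lee_fin content_ge0.
  rewrite -(fineK Sfin) -EFinD lee_fin; apply: content_le => f /H.
  by rewrite -(fineK Sfin) -EFinD lee_fin.
move=> [cf f01 f0].
pose C := [set x | e <= f x].
have cC : compact C.
  by apply: (subclosed_compact _ cT) => //; exact: cts_closed_ge.
have [N CN] : exists N, C `<=` \big[setU/set0]_(i < N) V i.
  have /compact_near_coveringP := cC.
  (* The finite unions increase with [N], so that a bound on [N] near each point of [C] gives one
     bound for all of [C]. *)
  move=> /(_ nat \oo (fun N x => (\big[setU/set0]_(i < N) V i) x) _) [x Cx|N _].
    have [i _ Vix] : (\bigcup_i V i) x.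
      apply: contrapT => nx; move: Cx; rewrite /C/= f0//.
      by rewrite leNgt e0.
    exists (V i, [set N | (i < N)%N]).
      split; last by exists i.+1.
      by apply: open_nbhs_nbhs; split; [exact: oV|exact: Vix].
    by move=> [y N] [/= Viy iN]; rewrite -bigcup_mkord; exists i.
  by move=> /(_ N (leqnn N)) CN; exists N.
have [oU lamU] := content_bigsetU N oV.
have Lf : L f <= \sum_(i < N) lam (V i) + e.
  apply: (le_trans (L_cut e cf)); rewrite lerD2r; apply: le_trans lamU.
  apply: le_content; split; first exact: cut_cts.
    move=> x; case/andP: (f01 x) => fx0 fx1; rewrite cut_ge0/=.
    exact: le_trans (cut_le (ltW e0) fx0) fx1.
  move=> x nx; rewrite cut_eq0//; rewrite leNgt; apply/negP => /ltW ef.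
  exact/nx/CN.
apply: (@le_trans _ _ (\sum_(i < N) (lam (V i))%:E + e%:E)%E).
  by rewrite sumEFin -EFinD lee_fin.
rewrite leeD2r//.
rewrite -(big_mkord xpredT (fun i => (lam (V i))%:E)).
by apply: nneseries_lim_ge => n _; rewrite lee_fin content_ge0.
Qed.

Definition riesz_outer A : \bar R :=
  ereal_inf [set (lam V)%:E | V in [set V | open V /\ A `<=` V]].
Local Notation mu := riesz_outer.

Lemma riesz_outer_le A V : open V -> A `<=` V -> (mu A <= (lam V)%:E)%E.
Proof. by move=> oV AV; apply: ereal_inf_lbound; exists V. Qed.

Lemma riesz_outer_ge0 A : (0 <= mu A)%E.
Proof. by apply: le_ereal_inf_tmp => _ [V _ <-]; rewrite lee_fin content_ge0. Qed.

Lemma riesz_outer_fin A : mu A \is a fin_num.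
Proof.
rewrite ge0_fin_numE ?riesz_outer_ge0//.
apply: (@le_lt_trans _ _ (lam setT)%:E); last exact: ltey.
by apply: riesz_outer_le => //; exact: openT.
Qed.

Lemma riesz_outer_open V : open V -> mu V = (lam V)%:E.
Proof.
move=> oV; apply/eqP; rewrite eq_le riesz_outer_le//=.
by apply: le_ereal_inf_tmp => _ [W [_ VW] <-]; rewrite lee_fin le_content_sub.
Qed.

Lemma riesz_outer_approx A e : 0 < e ->
  exists V, [/\ open V, A `<=` V & ((lam V)%:E <= mu A + e%:E)%E].
Proof.
move=> e0; have := riesz_outer_fin A.
move=> /(lb_ereal_inf_adherent e0) [_ [V [oV AV] <-] Ve].
by exists V; split => //; exact: ltW.
Qed.

Lemma riesz_outer0 : mu set0 = 0%E.
Proof. by rewrite riesz_outer_open ?content0//; exact: open0. Qed.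

Lemma le_riesz_outer : {homo mu : A B / A `<=` B >-> (A <= B)%E}.
Proof.
move=> A B AB; apply: le_ereal_inf_tmp => _ [V [oV BV] <-]; apply: riesz_outer_le => //.
exact: subset_trans BV.
Qed.

Lemma riesz_outer_sigma_subadditive : sigma_subadditive mu.
Proof.
move=> F; apply/lee_addgt0Pr => _/posnumP[e].
have e2 n : 0 < e%:num / (2 ^ n.+1)%:R by rewrite divr_gt0// ltr0n expn_gt0.
pose V n := sval (cid (riesz_outer_approx (F n) (e2 n))).
have VP n : [/\ open (V n), F n `<=` V n &
    ((lam (V n))%:E <= mu (F n) + (e%:num / (2 ^ n.+1)%:R)%:E)%E].
  by rewrite /V; case: cid.
apply: (@le_trans _ _ (lam (\bigcup_n V n))%:E).
  apply: riesz_outer_le; first by apply: bigcup_open => n _; case: (VP n).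
  by apply: subset_bigcup => n _; case: (VP n).
apply: (@le_trans _ _ (\sum_(n <oo) (lam (V n))%:E)%E).
  by apply: content_bigcup => n; case: (VP n).
apply: le_trans (epsilon_trick _ _ (ltW _)) => //; last first.
  by move=> n; exact: riesz_outer_ge0.
apply: lee_nneseries => n _; first by rewrite lee_fin content_ge0.
by case: (VP n).
Qed.

Definition riesz_outer_measure : {outer_measure set T -> \bar R} :=
  HB.pack_for {outer_measure set T -> \bar R} mu
    (isOuterMeasure.Build R T mu riesz_outer0
      riesz_outer_ge0 le_riesz_outer riesz_outer_sigma_subadditive).

(** Take [f] below [W] and [V], then [g] below the open set of points of [W] with [f < e], which
    contains [W] minus [V]. Where [g] is nonzero [cut e f] vanishes, so their sum is still below
    [W]. *)
Lemma content_split V W : open V -> open W ->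
  ((lam (W `&` V))%:E + mu (W `&` ~` V) <= (lam W)%:E)%E.
Proof.
move=> oV oW; rewrite -(fineK (riesz_outer_fin _)) -EFinD lee_fin.
set c := fine _.
rewrite -lerBrDr; apply: content_le => f fWV; rewrite lerBrDr.
apply/ler_addgt0Pr => e e0; case: (fWV) => cf f01 f0.
pose C := [set x | e <= f x].
have cC : closed C by exact: cts_closed_ge.
have cWC : c <= lam (W `&` ~` C).
  rewrite -lee_fin /c (fineK (riesz_outer_fin _)); apply: riesz_outer_le.
    by apply: openI => //; exact: closed_openC.
  move=> x [Wx nV]; split => //; rewrite /C/= f0; first by rewrite leNgt e0.
  by case.
apply: (@le_trans _ _ (L (cut e f) + e + lam (W `&` ~` C))).
  by apply: lerD => //; exact: L_cut.
rewrite addrAC lerD2r -lerBrDl; apply: content_le => g [cg g01 g0].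
rewrite lerBrDl -(stateD sL)//; last exact: cut_cts.
apply: le_content; split; first by apply: ctsD => //; exact: cut_cts.
  move=> x; case/andP: (g01 x) => gx0 gx1; case/andP: (f01 x) => fx0 fx1.
  rewrite addr_ge0 ?cut_ge0//=; have [ef|fe] := leP e (f x).
    rewrite (g0 x) ?addr0; first exact: le_trans (cut_le (ltW e0) fx0) fx1.
    by case=> _; apply.
  by rewrite cut_eq0 ?add0r// ltW.
move=> x nW; rewrite (g0 x); last by case.
by rewrite cut_eq0 ?addr0// f0 ?ltW//; case.
Qed.

(** The test set is enlarged to an open set of nearly the same outer measure, to which
    [content_split] applies. *)
Lemma open_caratheodory V : open V -> caratheodory_measurable mu V.
Proof.
move=> oV; apply: (@le_caratheodory_measurable _ _ riesz_outer_measure) => X.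
apply/lee_addgt0Pr => e e0.
have [W [oW XW We]] := riesz_outer_approx X e0.
apply: le_trans We; apply: le_trans (content_split oV oW).
rewrite -riesz_outer_open; last exact: openI.
by apply: leeD; apply: le_riesz_outer; exact: setSI.
Qed.

End RieszOuterMeasure.

(** Truncating [y] at height [a] and adding its slice of thickness [b] above [a] truncates it at
    [a + b]: the induction step for sums of slices. *)
Lemma min_max_slice (R : realType) (a b y : R) : 0 <= b ->
  Num.min y a + Num.min (Num.max 0 (y - a)) b = Num.min y (a + b).
Proof.
move=> b0.
case: (leP y a) => ya.
  have -> : Num.max 0 (y - a) = 0 by apply/max_idPl; lra.
  have -> : Num.min 0 b = 0 by apply/min_idPl.
  have -> : Num.min y (a + b) = y by apply/min_idPl; lra.
  lra.
have -> : Num.max 0 (y - a) = y - a by apply/max_idPr; lra.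
by case: (leP (y - a) b) => h; case: (leP y (a + b)) => h'; lra.
Qed.

(** * Integration of continuous functions on the Borel space *)

Section BorelIntegral.
Variables (R : realType) (K : topologicalType) (hK : [set: K] !=set0).

Lemma open_measurable_borel (V : set K) : open V ->
  measurable (V : set (borel_space hK)).
Proof. by move=> oV; exact: sub_sigma_algebra. Qed.

Lemma closed_measurable_borel (V : set K) : closed V ->
  measurable (V : set (borel_space hK)).
Proof.
move=> cV; rewrite -(setCK V); apply: measurableC.
by apply: open_measurable_borel; exact: closed_openC.
Qed.

Lemma cts_measurable_borel (f : K -> R) : continuous f ->
  measurable_fun [set: borel_space hK] (f : borel_space hK -> R).
Proof.
move=> cf; apply: (measurability _ (RGenOInfty.measurableE R)) => //.
move=> _ [_ [a ->] <-]; rewrite setTI; apply: open_measurable_borel.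
have -> : f @^-1` `]a, +oo[ = [set x | a < f x].
  by apply/seteqP; split => x /=; rewrite in_itv/= andbT.
exact: cts_open_gt.
Qed.

Variable mu : probability (borel_space hK) R.

Lemma cts_integrable (f : K -> R) : compact [set: K] -> continuous f ->
  mu.-integrable [set: borel_space hK] (EFin \o (f : borel_space hK -> R)).
Proof.
move=> cK cf; have [M fM] := compact_fun_bounded cK cf.
apply: measurable_bounded_integrable => //.
- by rewrite (le_lt_trans (probability_le1 _ _)) ?ltey.
- exact: cts_measurable_borel.
- exists M; split; first exact: num_real.
  by move=> y My x _ /=; exact: le_trans (fM x) (ltW My).
Qed.

End BorelIntegral.

(** * The Riesz measure, its regularity and its integral *)

Section RieszMeasure.
Variables (R : realType) (K : topologicalType) (L : (K -> R) -> R).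
Hypotheses (hK : hausdorff_space K) (cK : compact [set: K]) (sL : state L).
Let K0 : [set: K] !=set0 := state_nonempty sL.

Local Notation mu := (riesz_outer L).

Let omu : {outer_measure set (pointed_space K0) -> \bar R} :=
  riesz_outer_measure hK cK sL.

Lemma borel_caratheodory (A : set (borel_space K0)) : measurable A ->
  caratheodory_measurable mu A.
Proof.
move=> mA; apply: (smallest_sub _ _ mA).
- split.
  + exact: (@caratheodory_measurable_set0 R (pointed_space K0) omu).
  + move=> B; rewrite setTD.
    exact: (@caratheodory_measurable_setC R (pointed_space K0) omu).
  + exact: (@caratheodory_measurable_bigcup R (pointed_space K0) omu).
- by move=> V oV; exact: (open_caratheodory hK cK sL).
Qed.

(* The value [0] off the Borel sets is what [rp_off_borel] demands. *)
Definition riesz_measure (A : set (borel_space K0)) : \bar R :=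
  if `[< measurable A >] then mu A else 0%E.

Lemma riesz_measureE (A : set (borel_space K0)) : measurable A ->
  riesz_measure A = mu A.
Proof. by move=> mA; rewrite /riesz_measure asboolT. Qed.

Lemma riesz_measure0 : riesz_measure set0 = 0%E.
Proof. by rewrite riesz_measureE// riesz_outer0. Qed.

Lemma riesz_measure_ge0 A : (0 <= riesz_measure A)%E.
Proof. by rewrite /riesz_measure; case: ifP => // _; exact: riesz_outer_ge0. Qed.

Lemma riesz_measure_sigma_additive : semi_sigma_additive riesz_measure.
Proof.
move=> F mF tF mUF; rewrite riesz_measureE//.
have := @caratheodory_measure_sigma_additive R (pointed_space K0) omu F.
move=> /(_ (fun n => borel_caratheodory (mF n)) tF (borel_caratheodory mUF)).
rewrite (_ : (fun n => _) = (fun n => \sum_(0 <= i < n) riesz_measure (F i))%E)//.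
by apply/funext => n; apply: eq_bigr => i _; rewrite riesz_measureE.
Qed.

Lemma riesz_measure_setT : riesz_measure setT = 1%E.
Proof.
by rewrite riesz_measureE// riesz_outer_open ?content_setT//; exact: openT.
Qed.

Definition riesz_measure_pack : {measure set (borel_space K0) -> \bar R} :=
  HB.pack_for {measure set (borel_space K0) -> \bar R} riesz_measure
    (isMeasure.Build _ (borel_space K0) R riesz_measure
      riesz_measure0 riesz_measure_ge0 riesz_measure_sigma_additive).

(** The total mass is already [1], so normalizing changes no value and only supplies the probability
    structure; [dirac point] is the fallback of [mnormalize] for degenerate mass. *)
Definition riesz_probability : probability (borel_space K0) R :=
  mnormalize riesz_measure_pack (dirac point).

Lemma riesz_probabilityE A : riesz_probability A = riesz_measure A.
Proof.
rewrite /riesz_probability /= /mnormalize /= riesz_measure_setT onee_eq0/=.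
by rewrite invr1 mule1.
Qed.

Local Notation P := riesz_probability.

Lemma riesz_probability_open V : open V -> P V = (riesz_content L V)%:E.
Proof.
move=> oV; rewrite riesz_probabilityE riesz_measureE ?riesz_outer_open//.
exact: open_measurable_borel.
Qed.

(** Outer regularity of the complement: an open set slightly larger than the complement of [A] has a
    compact complement inside [A], of nearly full measure. *)
Lemma riesz_inner_regular : inner_regular P.
Proof.
move=> A mA; apply/eqP; rewrite eq_le; apply/andP; split; last first.
  apply: ge_ereal_sup => _ [C [cC CA] <-]; apply: le_measure => //; rewrite inE//.
  by apply: closed_measurable_borel; exact: compact_closed.
apply/lee_addgt0Pr => e e0.
have [V [oV AV Ve]] := riesz_outer_approx sL (~` A) e0.
have mV : measurable (V : set (borel_space K0)) by exact: open_measurable_borel.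
apply: (@le_trans _ _ (P (~` V) + e%:E)%E); last first.
  rewrite leeD2r//; apply: ereal_sup_ubound; exists (~` V) => //; split.
    apply: (subclosed_compact _ cK) => //; exact: open_closedC.
  by rewrite -(setCK A); exact: subsetC.
have := Ve; rewrite -riesz_measureE; last exact: measurableC.
rewrite -riesz_probability_open// -riesz_probabilityE.
rewrite !probability_setC//.
rewrite -(fineK (fin_num_measure P A mA)) -(fineK (fin_num_measure P V mV)).
rewrite -!EFinB -!EFinD !lee_fin; lra.
Qed.

(* Layer cake: [f] is the sum of its slices [s k] between the heights [k/N] and
   [(k+1)/N]; the functional is bounded above and the integral below by the
   measures of the level sets, which match after a shift of [k]. *)
Lemma riesz_le_integral (f : K -> R) : continuous f -> (forall x, 0 <= f x <= 1) ->
  L f <= \int[P]_x (f x).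
Proof.
move=> cf f01; apply/ler_addgt0Pr => e; move: (e : R) => {}e e0.
have [N N0 Ne] : exists2 N : nat, 0 < N%:R :> R & N%:R^-1 <= e.
  exists (Num.truncn e^-1).+1; first by rewrite ltr0n.
  by rewrite invf_ple ?posrE ?ltr0n// ltW// truncnS_gt.
pose V k := [set x | k%:R / N%:R < f x].
have oV k : open (V k) by exact: cts_open_gt.
have mV k : measurable (V k : set (borel_space K0)) by exact: open_measurable_borel.
pose s k x := Num.min (Num.max 0 (f x - k%:R / N%:R)) N%:R^-1.
have cs k : continuous (s k).
  apply: cts_min; last exact: ctsC.
  apply: cts_max; first exact: ctsC.
  by apply: ctsB => //; exact: ctsC.
(* The first [n] slices add up to [f] truncated at height [n/N]. *)
have sumf n x : \sum_(k < n) s k x = Num.min (f x) (n%:R / N%:R).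
  case/andP: (f01 x) => fx0 _.
  elim: n => [|n IH]; first by rewrite big_ord0 mul0r; apply/esym/min_idPr.
  rewrite big_ord_recr/= IH /s -natr1 mulrDl mul1r.
  have : 0 <= N%:R^-1 :> R by rewrite invr_ge0 ltW.
  by move=> b0; rewrite min_max_slice.
have fE : f = fun x => \sum_(k < N) s k x.
  apply/funext => x; rewrite sumf divff ?gt_eqF//; apply/esym/min_idPl.
  by case/andP: (f01 x).
(* [N%:R * s k] has values between [0] and [1] and vanishes off [V k], so it is below [V k]. *)
have Ls k : L (s k) <= fine (P (V k)) / N%:R.
  rewrite ler_pdivlMr// mulrC -(stateZ sL)// riesz_probability_open//=; last exact: oV.
  apply: (le_content sL); split.
  - by apply: ctsM => //; exact: ctsC.
  - move=> x; rewrite mulr_ge0 ?ler0n//=; last first.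
      by rewrite /s le_min le_max lexx/= invr_ge0 ler0n.
    by rewrite -ler_pdivlMl// mulr1 /s ge_min lexx orbT.
  - move=> x /negP; rewrite -leNgt => fk.
    have -> : s k x = 0; last by rewrite mulr0.
    rewrite /s; have -> : Num.max 0 (f x - k%:R / N%:R) = 0.
      by apply/max_idPl; rewrite subr_le0.
    by apply/min_idPl; rewrite invr_ge0 ler0n.
(* On [V k.+1] the slice [s k] has its full thickness [1/N]. *)
have Is k : fine (P (V k.+1)) / N%:R <= \int[P]_x (s k x).
  rewrite mulrC -(Rintegral_cst P (mV k.+1)) Rintegral_mkcond.
  apply: le_Rintegral => //.
  - rewrite (_ : _ \o _ = fun x => (N%:R^-1%:E * (\1_(V k.+1) x)%:E)%E).
      by apply: integrableZl => //; exact: integrable_indic.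
    apply/funext => x /=; rewrite patchE indicE.
    by case: ifPn => _; rewrite -EFinM ?mulr1 ?mulr0.
  - exact: cts_integrable.
  - move=> x _; rewrite patchE; case: ifPn => [|_]; last first.
      by rewrite /s le_min le_max lexx/= invr_ge0 ler0n.
    rewrite inE /V/= -natr1 mulrDl mul1r => xk.
    by rewrite /s le_min lexx andbT le_max lerBrDl (ltW xk) orbT.
have -> : \int[P]_x (f x) = \sum_(k < N) \int[P]_x (s k x).
  rewrite [in LHS]fE; elim: (N) => [|n IH].
    rewrite big_ord0; under eq_Rintegral do rewrite big_ord0.
    by rewrite Rintegral_cst// mul0r.
  under eq_Rintegral do rewrite big_ord_recr/=.
  rewrite RintegralD//; last 2 first.
  - by apply: cts_integrable => //; exact: cts_sum.
  - exact: cts_integrable.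
  by rewrite big_ord_recr/= IH.
rewrite [in L f]fE (state_sum sL)//.
apply: (@le_trans _ _ (\sum_(k < N) fine (P (V k)) / N%:R)); first exact: ler_sum.
apply: (@le_trans _ _ (\sum_(k < N) fine (P (V k.+1)) / N%:R + e)); last first.
  by rewrite lerD2r; exact: ler_sum.
(* The two sums differ by their end terms only: the one for [V 0] is at most [1/N], hence at most
   [e], and the one for [V N] is nonnegative. *)
have -> : \sum_(k < N) fine (P (V k.+1)) / N%:R
   = \sum_(k < N.+1) fine (P (V k)) / N%:R - fine (P (V 0%N)) / N%:R.
  by rewrite big_ord_recl/= addrAC subrr add0r.
rewrite big_ord_recr/=.
have p0 : 0 <= fine (P (V N)) / N%:R by rewrite divr_ge0 ?fine_ge0 ?ler0n.
have p1 : fine (P (V 0%N)) / N%:R <= e.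
  apply: le_trans Ne; rewrite ler_piMl ?invr_ge0 ?ler0n//.
  rewrite -lee_fin fineK ?probability_le1//; exact: fin_num_measure.
lra.
Qed.
End RieszMeasure.

Section StateUniqueness.
Variables (R : realType) (K : topologicalType).
Hypothesis cK : compact [set: K].

(** The inequality for [g] and for [1 - g] gives equality when [g] has values between [0] and [1],
    and a bounded [f] is an affine image of such a [g]. *)
Lemma state_eq (L I : (K -> R) -> R) : state L -> state I ->
  (forall f : K -> R, continuous f -> (forall x, 0 <= f x <= 1) -> L f <= I f) ->
  forall f : K -> R, continuous f -> L f = I f.
Proof.
move=> sL sI LI f cf; have [M fM] := compact_fun_bounded cK cf.
have [m m0 fm] : exists2 m : R, 0 < m & forall x, - m <= f x <= m.
  exists (Num.max 1 M); first by rewrite lt_max ltr01.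
  by move=> x; rewrite -ler_norml le_max fM orbT.
pose g x := (2 * m)^-1 * (f x + m).
have m2 : 0 < 2 * m by lra.
have cg : continuous g.
  by apply: ctsM; [exact: ctsC|apply: ctsD => //; exact: ctsC].
have g01 x : 0 <= g x <= 1.
  case/andP: (fm x) => ? ?; rewrite /g; apply/andP; split.
    by rewrite mulr_ge0 ?invr_ge0 ?(ltW m2)//; lra.
  by rewrite ler_pdivrMl//; lra.
have Lg : L g = I g.
  apply/eqP; rewrite eq_le LI//=.
  have := LI (fun x => 1 - g x) _ _.
  rewrite (stateB sL)//; last exact: ctsC.
  rewrite (stateB sI)//; last exact: ctsC.
  rewrite (state_cst sL) (state_cst sI) lerD2l lerN2; apply.
    by apply: ctsB => //; exact: ctsC.
  by move=> x; case/andP: (g01 x) => ? ?; lra.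
have -> : f = fun x => 2 * m * g x - m.
  by apply/funext => x; rewrite /g mulrA divff ?gt_eqF// mul1r addrK.
have cmg : continuous (fun x => 2 * m * g x) by apply: ctsM => //; exact: ctsC.
have cm : continuous (fun _ : K => m) by exact: ctsC.
by rewrite (stateB sL)// (stateB sI)// (stateZ sL)// (stateZ sI)// Lg
  (state_cst sL) (state_cst sI).
Qed.

Lemma probability_state (hK : [set: K] !=set0)
    (mu : probability (borel_space hK) R) :
  state (fun f : K -> R => \int[mu]_x (f x)).
Proof.
split.
- move=> f g cf cg; apply: RintegralD => //; exact: cts_integrable.
- move=> a f cf; apply: RintegralZl => //; exact: cts_integrable.
- by move=> f cf f0; apply: Rintegral_ge0.
- rewrite Rintegral_cst// mul1r -[RHS]/(fine 1%E); congr fine.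
  exact: (probability_setT mu).
Qed.

End StateUniqueness.

Section Riesz.
Variables (R : realType) (K : topologicalType).
Hypotheses (hK : hausdorff_space K) (cK : compact [set: K]).

Lemma rp_state (mu : radon_probability R K) :
  state (fun f : K -> R => rp_integral f mu).
Proof. exact: probability_state. Qed.

Theorem riesz_radon (L : (K -> R) -> R) : state L ->
  exists mu : radon_probability R K,
    forall f : K -> R, continuous f -> rp_integral f mu = L f.
Proof.
move=> sL; pose P := riesz_probability hK cK sL.
have off A : ~ measurable A -> P A = 0%E.
  by move=> nA; rewrite riesz_probabilityE /riesz_measure asboolF.
exists (@RadonProbability R K (state_nonempty sL) P (@riesz_inner_regular R K L hK cK sL) off) => f cf.
apply/esym; apply: (state_eq cK sL (probability_state cK P)) => // {f cf}.
by move=> f cf f01; exact: riesz_le_integral.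
Qed.

End Riesz.

(** * The weak topology *)

Lemma ultra_fmap (T U : Type) (f : T -> U) (F : set_system T) :
  UltraFilter F -> UltraFilter (f @ F).
Proof.
move=> FU; split; first exact: fmap_proper_filter.
move=> G GF FG; apply/seteqP; split=> [A GA|]; last exact: FG.
have [//|FnA] := in_ultra_setVsetC (f @^-1` A) FU.
have GnA : G (~` A) by apply: FG.
by have [x []] := filter_ex (filterI GA GnA).
Qed.

(** Limits along one fixed ultrafilter on the indices replace convergent subsequences, which a
    compact space need not provide. *)
Lemma compact_ultra_cvg (I : Type) (U : set_system I) (T : topologicalType)
    (A : set T) (x : I -> T) : UltraFilter U -> compact A ->
  U (x @^-1` A) -> exists2 p, A p & x @ U --> p.
Proof.
move=> UU cA UA; have UxU := ultra_fmap x UU.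
by move: cA; rewrite compact_ultra => /(_ _ UxU UA) [p [Ap xp]]; exists p.
Qed.

Section WeakTopology.
Variables (R : realType) (K : topologicalType).
Notation P := (radon_probability R K).

Lemma rp_cvgP (F : set_system P) (mu : P) : Filter F ->
  F --> mu <-> forall f : K -> R, continuous f ->
    rp_integral f @ F --> rp_integral f mu.
Proof.
move=> FF; split=> [Fmu f cf|Fmu].
  have /(cvg_sup _ _ FF) /(_ (exist _ f cf)) H := Fmu.
  move=> A /(@initial_continuous _ _ (rp_integral f) mu) /H.
  by [].
apply/(@cvg_sup _ _ _ _ _ FF) => -[f cf] A [_ [[B oB <-] Bf BA]].
apply: (filterS BA); apply: (Fmu f cf).
by apply: open_nbhs_nbhs; split.
Qed.

Lemma rp_integral_continuous (f : K -> R) : continuous f ->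
  continuous (rp_integral f : P -> R).
Proof.
move=> cf mu; apply: (proj1 (@rp_cvgP (nbhs mu) mu _)) => //.
Qed.

(** The sets [A] with this property form a filter along which every integral converges to its value
    at [mu]; by [rp_cvgP] this filter contains all neighbourhoods of [mu]. *)
Lemma rp_nbhsP (mu : P) (A : set P) : nbhs mu A ->
  exists (I : finType) (f : I -> K -> R) (e : R),
    [/\ 0 < e, forall i, continuous (f i) &
     forall nu, (forall i, `|rp_integral (f i) nu - rp_integral (f i) mu| < e) ->
       A nu].
Proof.
pose G : set_system P := [set A | exists (I : finType) (f : I -> K -> R) (e : R),
    [/\ 0 < e, forall i, continuous (f i) &
     forall nu, (forall i, `|rp_integral (f i) nu - rp_integral (f i) mu| < e) ->
       A nu]].
suff : G --> mu by apply.
have FG : Filter G.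
  split.
  - exists void, (fun v : void => match v return K -> R with end), 1; split => //.
  - move=> B C [I [f [e [e0 cf fB]]]] [J [g [d [d0 cg gC]]]].
    exists (I + J)%type.
    exists (fun k => match k with inl i => f i | inr j => g j end).
    exists (Num.min e d); split; [by rewrite lt_min e0|by case|].
    move=> nu H; split.
      by apply: fB => i; have := H (inl i); rewrite lt_min => /andP[].
    by apply: gC => j; have := H (inr j); rewrite lt_min => /andP[].
  - move=> B C BC [I [f [e [e0 cf fB]]]]; exists I, f, e; split => // nu /fB.
    exact: BC.
apply/rp_cvgP => f cf; apply/cvgrPdist_lt => e e0.
exists unit, (fun _ => f), e; split => // nu /(_ tt).
by rewrite distrC.
Qed.

Hypotheses (hK : hausdorff_space K) (cK : compact [set: K]).

(** Expresses concentration through integrals, so that it survives weak limits. For the converse,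
    inner regularity reduces the mass off [C] to compact sets [D] disjoint from [C]; with [f] equal
    to [0] on [D] and [1] on [C], the function [1 - f] has integral [0] and dominates the indicator
    of [D]. *)
Lemma concentratedP (mu : P) (C : set K) : closed C ->
  rp_measure mu C = 1%E <->
  (forall f : K -> R, continuous f -> (forall x, 0 <= f x <= 1) ->
    (forall x, C x -> f x = 1) -> rp_integral f mu = 1).
Proof.
move=> cC; have mC := @closed_measurable_borel _ (rp_nonempty mu) _ cC.
split=> [muC f cf f01 f1|H].
  apply/eqP; rewrite eq_le; apply/andP; split.
    rewrite -[leRHS](state_cst (rp_state cK mu)).
    apply: (le_state (rp_state cK mu)) => //; first exact: ctsC.
    by move=> x; case/andP: (f01 x).
  have -> : 1 = fine (rp_measure mu C) :> R by rewrite muC.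
  rewrite -[leLHS]mul1r -(Rintegral_cst _ mC) Rintegral_mkcond.
  apply: le_Rintegral => //.
  - rewrite (_ : _ \o _ = fun x => (\1_C x)%:E).
      exact: integrable_indic.
    by apply/funext => x /=; rewrite patchE indicE; case: ifPn.
  - exact: cts_integrable.
  - move=> x _; rewrite patchE; case: ifPn => [|_]; last by case/andP: (f01 x).
    by rewrite inE => /f1 ->.
have mCc : measurable (~` C : set (borel_space (rp_nonempty mu))).
  exact: measurableC.
suff C0 : rp_measure mu (~` C) = 0%E.
  by have := probability_setC (rp_measure mu) mCc; rewrite C0 setCK sube0.
rewrite (rp_inner_regular (r := mu) mCc).
apply/eqP; rewrite eq_le; apply/andP; split; last first.
  apply: ereal_sup_ubound; exists set0; last exact: measure0.
  by split; [exact: compact0|].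
apply: ge_ereal_sup => _ [D [cD DC] <-].
have cD' : closed D by exact: compact_closed.
have mD := @closed_measurable_borel _ (rp_nonempty mu) _ cD'.
have [|f [cf f01 f0 f1]] := @urysohn01 R K D C hK cK cD' cC.
  by rewrite -subset0 => x [/DC].
have := H f cf f01 f1 => If.
have I1 : rp_integral (fun x => 1 - f x) mu = 0.
  rewrite (stateB (rp_state cK mu)) ?If ?(state_cst (rp_state cK mu)) ?subrr//.
  exact: ctsC.
have : fine (rp_measure mu D) <= rp_integral (fun x => 1 - f x) mu.
  rewrite -[leLHS]mul1r -(Rintegral_cst _ mD) Rintegral_mkcond.
  apply: le_Rintegral => //.
  - rewrite (_ : _ \o _ = fun x => (\1_D x)%:E).
      exact: integrable_indic.
    by apply/funext => x /=; rewrite patchE indicE; case: ifPn.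
  - by apply: cts_integrable => //; apply: ctsB => //; exact: ctsC.
  - move=> x _; rewrite patchE; case: ifPn => [|_].
      by rewrite inE => /f0 ->; rewrite subr0.
    by case/andP: (f01 x) => ? ?; rewrite subr_ge0.
rewrite I1 -lee_fin fineK//; exact: fin_num_measure.
Qed.

(** Along an ultrafilter all integrals converge and their limits form a state; the Riesz measure of
    this state is the limit, and [concentratedP] keeps it on [C]. *)
Lemma concentrated_compact (C : set K) : closed C ->
  compact [set mu : P | rp_measure mu C = 1%E].
Proof.
move=> cC; rewrite compact_ultra => F UF FC.
(* For discontinuous [f] this may be a default value, which the notion of state allows. *)
pose L f : R := lim (rp_integral f @ F).
have cvL (f : K -> R) : continuous f -> rp_integral f @ F --> L f.
  move=> cf; have [M fM] := compact_fun_bounded cK cf.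
  have [||p _ Fp] := @compact_ultra_cvg P F R `[- M, M]%classic (rp_integral f) UF.
  - exact: segment_compact.
  - apply: (@filterS _ _ _ setT); last exact: filterT.
    move=> mu _ /=; rewrite in_itv/= -ler_norml -[rp_integral f mu]subr0.
    rewrite -[X in _ - X](state_cst (rp_state cK mu)).
    apply: (state_dist (rp_state cK mu)) => //; first exact: ctsC.
    by move=> x; rewrite subr0.
  - by rewrite /L (cvg_lim _ Fp).
have LE (f : K -> R) l : rp_integral f @ F --> l -> L f = l.
  by move=> Fl; rewrite /L (cvg_lim _ Fl).
have sL : state L.
  split.
  - move=> f g cf cg; apply: LE.
    rewrite (_ : rp_integral _ = fun mu => rp_integral f mu + rp_integral g mu).
      by apply: cvgD; exact: cvL.
    by apply/funext => mu; rewrite (stateD (rp_state cK mu)).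
  - move=> a f cf; apply: LE.
    rewrite (_ : rp_integral _ = fun mu => a * rp_integral f mu).
      by apply: cvgM; [exact: cvg_cst|exact: cvL].
    by apply/funext => mu; rewrite (stateZ (rp_state cK mu)).
  - move=> f cf f0; apply: limr_ge; first by apply/cvg_ex; exists (L f); exact: cvL.
    by apply: nearW => mu; exact: (state_ge0 (rp_state cK mu)).
  - apply: LE; rewrite (_ : rp_integral _ = fun=> 1); first exact: cvg_cst.
    by apply/funext => mu; rewrite (state_cst (rp_state cK mu)).
have [mu muL] := riesz_radon hK cK sL.
exists mu; split.
  apply/concentratedP => // f cf f01 f1; rewrite muL//; apply: LE.
  apply: (@cvg_trans _ ((fun=> 1) @ F)); last exact: cvg_cst.
  apply: near_eq_cvg; apply: filterS FC => nu.
  by move=> /(concentratedP _ cC) /(_ f cf f01 f1) ->.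
apply/rp_cvgP => f cf; rewrite muL//; exact: cvL.
Qed.

End WeakTopology.

(** * The Stone-Cech compactification *)

Section SetType.
Variables (Z : topologicalType) (A : set Z).

Lemma set_val_continuous : continuous (set_val : A -> Z).
Proof. exact: initial_continuous. Qed.

Lemma set_type_cvgP (F : set_system A) (y : A) : Filter F ->
  F --> y <-> set_val @ F --> set_val y.
Proof.
move=> FF; split=> [Fy B /(@set_val_continuous y) /Fy //|Fy V].
by move=> [_ [[B oB <-] By BV]]; apply: (filterS BV); apply: Fy;
  apply: open_nbhs_nbhs; split.
Qed.

Lemma set_type_nbhs (y : A) (V : set A) : nbhs y V ->
  exists2 B : set Z, nbhs (set_val y) B & set_val @^-1` B `<=` V.
Proof.
move=> [_ [[B oB <-] By BV]]; exists B => //.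
by apply: open_nbhs_nbhs; split.
Qed.

Lemma compact_set_type (B : set Z) : compact B -> B `<=` A ->
  compact (set_val @^-1` B : set A).
Proof.
move=> cB BA; rewrite compact_ultra => F UF FB.
have [p Bp Fp] := compact_ultra_cvg UF cB FB.
have pA : p \in A by apply/mem_set/BA.
by exists (SigSub pA); split => //; apply/set_type_cvgP.
Qed.

Lemma hausdorff_set_type : hausdorff_space Z -> hausdorff_space A.
Proof.
move=> hZ x y cxy; apply/val_inj/hZ => B C.
move=> /(@set_val_continuous x) Bx /(@set_val_continuous y) Cy.
by have [z [Bz Cz]] := cxy _ _ Bx Cy; exists (set_val z).
Qed.

End SetType.

Section StoneCechTheory.
Variables (R : realType) (X : topologicalType).
Local Notation bX := (stone_cech R X).
Local Notation I := {classic unit_fun R X}.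
Local Notation cube := {ptws unit_fun R X -> R}.
Local Notation emb := (@sc_embed R X).

Lemma cube_proj_continuous (i : unit_fun R X) : continuous (fun z : cube => z i).
Proof. exact: (@proj_continuous I (fun=> R) i). Qed.

Lemma cube_hausdorff : hausdorff_space cube.
Proof.
move=> z w czw; apply/funext => i; apply: (@Rhausdorff R (z i) (w i)) => B C.
move=> /(@cube_proj_continuous i z) Bz /(@cube_proj_continuous i w) Cw.
by have [v [Bv Cv]] := czw _ _ Bz Cw; exists (v i).
Qed.

Lemma stone_cech_hausdorff : hausdorff_space bX.
Proof. exact: hausdorff_set_type cube_hausdorff. Qed.

Lemma stone_cech_compact : compact [set: bX].
Proof.
have cc : compact [set f : cube | forall i, `[0, 1]%classic (f i)].
  exact: (@tychonoff I (fun=> R) (fun=> `[0, 1]%classic)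
    (fun=> @segment_compact R 0 1)).
have -> : [set: bX] = (set_val : bX -> cube) @^-1` (@stone_cech_set R X).
  by apply/seteqP; split => // z _; exact: set_valP.
apply: compact_set_type => //.
apply: (subclosed_compact _ cc); first exact: closed_closure.
(* The cube is compact in a Hausdorff space, hence closed, so the closure of the image of [X] stays
   inside it. *)
have clc : closed [set f : cube | forall i, `[0, 1]%classic (f i)].
  exact: compact_closed cube_hausdorff cc.
rewrite [X in _ `<=` X](proj1 (closure_id _) clc).
apply: closureS => _ [x _ <-] i /=; case: i => /= f [_ /(_ x)].
by rewrite in_itv.
Qed.

Lemma sc_embed_continuous : continuous emb.
Proof.
move=> x; apply/set_type_cvgP; apply/cvg_sup => -[f [cf f01]] A.
move=> [_ [[B oB <-] Bf BA]]; apply: (filterS BA); apply: (cf x).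
by apply: open_nbhs_nbhs; split.
Qed.

Lemma sc_embed_dense (z : bX) (A : set bX) : nbhs z A -> exists x, A (emb x).
Proof.
move=> /set_type_nbhs [B Bz BA].
have cz : closure (range (@sc_eval R X)) (set_val z) := set_valP z.
have [_ [[x _ <-] Bx]] := cz B Bz.
by exists x; apply: BA.
Qed.

Lemma sc_extend01 (f : X -> R) : continuous f -> (forall x, 0 <= f x <= 1) ->
  exists g : bX -> R, [/\ continuous g, forall z, 0 <= g z <= 1 &
    forall x, g (emb x) = f x].
Proof.
move=> cf f01; pose i : unit_fun R X := exist _ f (conj cf f01).
have ci : continuous (fun z : bX => set_val z i).
  move=> z; apply: (@continuous_comp _ _ _ set_val (fun z : cube => z i)).
    exact: set_val_continuous.
  exact: cube_proj_continuous.
(* The extension is the coordinate of index [f]. Clipping gives the bounds on all of [bX] at once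
   and changes nothing on the image of [X]. *)
exists (fun z => Num.min 1 (Num.max 0 (set_val z i))); split.
- by apply: cts_min; [exact: ctsC|apply: cts_max; [exact: ctsC|exact: ci]].
- by move=> z; rewrite ge_min lexx le_min ler01 le_max lexx.
- move=> x; case/andP: (f01 x) => fx0 fx1 /=.
  by rewrite /sc_eval/= (max_idPr _)// (min_idPr _).
Qed.

Lemma sc_nonempty : [set: bX] !=set0 -> [set: X] !=set0.
Proof. by move=> [z _]; have [|x _] := @sc_embed_dense z setT; [exact: filterT|exists x]. Qed.

Lemma sc_embed_compact (C : set X) : compact C -> compact (emb @` C).
Proof.
move=> cC; apply: continuous_compact => //.
by apply: continuous_subspaceT; exact: sc_embed_continuous.
Qed.

Lemma sc_embed_closed (C : set X) : compact C -> closed (emb @` C).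
Proof.
move=> cC; apply: compact_closed; first exact: stone_cech_hausdorff.
exact: sc_embed_compact.
Qed.

End StoneCechTheory.

(** * Pseudo-omega-bounded spaces *)

(** Needed for families indexed by all atoms of a sequence of measures. Codes that decode to nothing
    are sent to the index [j0]. *)
Lemma pob_countable (Z : topologicalType) (J : countType) (U : J -> set Z) :
  pseudo_omega_bounded Z -> (forall j, open (U j) /\ U j !=set0) ->
  exists K : set Z, compact K /\ forall j, U j `&` K !=set0.
Proof.
move=> pobZ HU; have [[j0 _]|nJ] := pselect (exists j : J, True); last first.
  exists set0; split; first exact: compact0.
  by move=> j; exfalso; apply: nJ; exists j.
pose V n := U (odflt j0 (unpickle n)).
have [K [cK VK]] := pobZ V (fun n => HU _).
exists K; split => // j; have := VK (pickle j).
by rewrite /V pickleK.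
Qed.

Lemma compact_pob (Z : topologicalType) : compact [set: Z] ->
  pseudo_omega_bounded Z.
Proof.
by move=> cZ U HU; exists setT; split => // n; rewrite setIT; case: (HU n).
Qed.

Lemma open_prod_box (A B : topologicalType) (U : set (A * B)) (p : A * B) :
  open U -> U p -> exists V W, [/\ open V, open W, V p.1, W p.2 & V `*` W `<=` U].
Proof.
rewrite openE => oU Up; have [[P Q] /= [nP nQ] PQ] := oU _ Up.
move: nP nQ; rewrite !nbhsE => -[V [oV Vp] VP] [W [oW Wp] WQ].
exists V, W; split => // -[a b] [/= Va Wb]; apply: PQ; split; [exact: VP|exact: WQ].
Qed.

Lemma pob_prod (A B : topologicalType) : pseudo_omega_bounded A ->
  pseudo_omega_bounded B -> pseudo_omega_bounded (A * B)%type.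
Proof.
move=> pA pB U HU.
have box n : exists VW : set A * set B, [/\ open VW.1 /\ VW.1 !=set0,
    open VW.2 /\ VW.2 !=set0 & VW.1 `*` VW.2 `<=` U n].
  have [oU [p Up]] := HU n.
  have [V [W [oV oW Vp Wp VW]]] := open_prod_box oU Up.
  by exists (V, W); split => //=; split => //; [exists p.1|exists p.2].
have [VW HVW] := choice box.
have [|K1 [cK1 VK1]] := pA (fun n => (VW n).1); first by move=> n; case: (HVW n).
have [|K2 [cK2 VK2]] := pB (fun n => (VW n).2); first by move=> n; case: (HVW n).
exists (K1 `*` K2); split; first exact: compact_setX.
move=> n; have [a [Va Ka]] := VK1 n; have [b [Vb Kb]] := VK2 n.
exists (a, b); split => //; case: (HVW n) => _ _; exact.
Qed.

(** A free ultrafilter: limits along it ignore any finite number of indices. *)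
Lemma nat_ultra : exists U : set_system nat,
  UltraFilter U /\ forall N, U [set n | (N <= n)%N].
Proof.
have [U [UU oU]] := ultraFilterLemma (eventually_filter : ProperFilter \oo).
by exists U; split => // N; apply: oU; exists N.
Qed.

(** * Pseudometrics with open balls *)

Section PseudoMetric.
Variables (R : realType) (Z : topologicalType) (d : Z -> Z -> R).
Hypotheses (dsym : forall x y, d x y = d y x)
  (dtri : forall x y z, d x z <= d x y + d y z)
  (dnear : forall x e, 0 < e -> nbhs x [set z | d z x < e]).

Lemma open_dball x e : open [set z | d z x < e].
Proof.
rewrite openE => z /= zx; have e0 : 0 < e - d z x by rewrite subr_gt0.
apply: filterS (dnear z e0) => w /= wz.
by have := dtri w z x; lra.
Qed.

(** Otherwise there is an [e]-separated sequence. A compact set meets all the balls of radius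
    [e / 3] around its terms, and two of the meeting points lie within [e / 6] of a common limit,
    which puts two terms at distance less than [e]. *)
Lemma pob_totally_bounded (e : R) : (forall x, d x x = 0) ->
  pseudo_omega_bounded Z -> 0 < e ->
  exists s : seq Z, forall z, exists2 b, b \in s & d z b < e.
Proof.
move=> d0 pobZ e0; apply: contrapT => ns.
have far (s : seq Z) : exists z, forall b, b \in s -> e <= d z b.
  apply: contrapT => nz; apply: ns; exists s => z.
  apply: contrapT => nb; apply: nz; exists z => b bs.
  by rewrite leNgt; apply/negP => zb; apply: nb; exists b.
have [g Hg] := choice far.
(* [s n] lists the first [n] terms, and [g (s n)] is the next one, at distance at least [e] from all
   of them. *)
pose s n := iter n (fun t => g t :: t) [::].
have smem m n : (m < n)%N -> g (s m) \in s n.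
  elim: n => // n IH; rewrite ltnS leq_eqVlt => /predU1P[->|mn] /=.
    by rewrite inE eqxx.
  by rewrite inE IH ?orbT.
have e3 : 0 < e / 3 by rewrite divr_gt0.
have [|K [cK VK]] := pobZ (fun n => [set z | d z (g (s n)) < e / 3]).
  by move=> n; split; [exact: open_dball|exists (g (s n)); rewrite /= d0].
have [y Hy] := choice VK.
have [U [UU UN]] := nat_ultra.
have [|p Kp yp] := @compact_ultra_cvg nat U Z K y UU cK.
  by apply: filterE => n; case: (Hy n).
have e6 : 0 < e / 6 by rewrite divr_gt0.
have UE : U [set n | d (y n) p < e / 6] by exact: (yp _ (dnear p e6)).
have [m /= my] := filter_ex UE.
have [n [/= ny mn]] := filter_ex (filterI UE (UN m.+1)).
have [ym _] := Hy m; have [yn _] := Hy n; rewrite /= in ym yn.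
have := Hg (s n) _ (smem m n mn).
have := dtri (g (s n)) (y n) (g (s m)).
have := dtri (y n) p (g (s m)); have := dtri p (y m) (g (s m)).
rewrite (dsym p (y m)) (dsym (g (s n)) (y n)).
lra.
Qed.

End PseudoMetric.

(** * Equicontinuity by a double limit *)

Section DoubleLimit.
Variables (R : realType) (A T : topologicalType) (F : A * T -> R) (x0 : A).
Hypotheses (pA : pseudo_omega_bounded A) (pT : pseudo_omega_bounded T)
  (cF : continuous F) (F0 : forall t, F (x0, t) = 0).

(* Otherwise one builds open sets [V n], [Q n] with [|F| > e] on [V n * Q n] and
   [|F| < e/2] on [V m * Q n] for [n < m]; at a limit of points of [V n * Q n]
   lying in a compact set the two iterated limits disagree. *)
Lemma pob_equicontinuous (e : R) : 0 < e ->
  nbhs x0 [set x | forall t, `|F (x, t)| <= e].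
Proof.
move=> e0; apply: contrapT => nn.
have cnF : continuous (fun p => `|F p|) by exact: cts_norm.
have e2 : 0 < e / 2 by rewrite divr_gt0.
(* [S] consists of the next [V n], the next [Q n] and the smaller neighbourhood of [x0] in which all
   later [V m] are chosen. *)
have step (W : set A) : nbhs x0 W -> exists S : set A * set T * set A,
    [/\ [/\ open S.1.1, S.1.1 !=set0 & S.1.1 `<=` W], open S.1.2 /\ S.1.2 !=set0,
      nbhs x0 S.2 /\ S.2 `<=` W,
      forall x t, S.1.1 x -> S.1.2 t -> e < `|F (x, t)| &
      forall x t, S.2 x -> S.1.2 t -> `|F (x, t)| < e / 2].
  move=> Wx0; have [x [t [Wx xt]]] : exists x t, W^° x /\ e < `|F (x, t)|.
    apply: contrapT => h; apply: nn;
    apply: filterS (nbhs_interior Wx0) => x Wx t; rewrite leNgt; apply/negP => xt.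
    by apply: h; exists x, t.
  have [V [Q [oV oQ Vx Qt VQ]]] := open_prod_box (cts_open_gt (e) cnF) xt.
  have x0t : `|F (x0, t)| < e / 2 by rewrite F0 normr0.
  have [W' [Q' [oW' oQ' W'x0 Q't WQ']]] :=
    open_prod_box (cts_open_lt (e / 2) cnF) x0t.
  exists (V `&` W^°, Q `&` Q', W' `&` W); split => /=.
  - split; [by apply: openI => //; exact: open_interior|by exists x|].
    by move=> z [_ /interior_subset].
  - by split; [exact: openI|exists t].
  - by split=> [|z []//]; apply: filterI => //; apply: open_nbhs_nbhs.
  - by move=> z s [Vz _] [Qs _]; exact: (VQ (z, s)).
  - by move=> z s [Wz _] [_ Qs]; exact: (WQ' (z, s)).
have [g Hg] := choice (fun W : {W : set A | nbhs x0 W} => step (proj1_sig W) (proj2_sig W)).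
have gn W : nbhs x0 (g W).2 by case: (Hg W) => _ _ [].
have nT : nbhs x0 setT by exact: filterT.
pose W n := iter n (fun W => exist (fun W => nbhs x0 W) (g W).2 (gn W))
  (exist _ setT nT).
have WS n : proj1_sig (W n.+1) = (g (W n)).2 by [].
have Wle m n : (m <= n)%N -> proj1_sig (W n) `<=` proj1_sig (W m).
  elim: n => [|n IH]; first by rewrite leqn0 => /eqP ->.
  rewrite leq_eqVlt => /predU1P[->//|mn].
  apply: subset_trans (IH mn); rewrite WS.
  by case: (Hg (W n)) => _ _ [].
have [|K1 [cK1 VK1]] := @pA (fun n => (g (W n)).1.1).
  by move=> n; case: (Hg (W n)) => -[].
have [|K2 [cK2 VK2]] := @pT (fun n => (g (W n)).1.2).
  by move=> n; case: (Hg (W n)) => _ -[].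
have [x Hx] := choice VK1; have [t Ht] := choice VK2.
have [U [UU UN]] := nat_ultra.
have [|p _ xp] := @compact_ultra_cvg nat U A K1 x UU cK1.
  by apply: filterE => n; case: (Hx n).
have [|q _ tq] := @compact_ultra_cvg nat U T K2 t UU cK2.
  by apply: filterE => n; case: (Ht n).
have diag n : e < `|F (x n, t n)|.
  case: (Hg (W n)) => _ _ _ + _; apply; first by case: (Hx n).
  by case: (Ht n).
have off n m : (n < m)%N -> `|F (x m, t n)| < e / 2.
  move=> nm; case: (Hg (W n)) => _ _ _ _; apply; last by case: (Ht n).
  rewrite -WS; apply: (Wle _ _ nm).
  by case: (Hg (W m)) => -[_ _ +] _ _ _ _; apply; case: (Hx m).
(* The diagonal limit keeps [|F|] at least [e]. *)
have Fpq : e <= `|F (p, q)|.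
  rewrite leNgt; apply/negP => pq.
  have [V [Q [oV oQ Vp Qq VQ]]] := open_prod_box (cts_open_lt (e) cnF) pq.
  have /filter_ex [n [/= Vn Qn]] : U (x @^-1` V `&` t @^-1` Q).
    by apply: filterI; [apply: xp|apply: tq]; apply: open_nbhs_nbhs.
  have /= := VQ (x n, t n) (conj Vn Qn).
  by rewrite ltNge (ltW (diag n)).
have pq : e / 2 < `|F (p, q)| by apply: lt_le_trans Fpq; lra.
(* The iterated limit: first [n] with [t n] in [Q], then [m > n] with [x m] in [V], where [|F|] is
   less than [e / 2]. *)
have [V [Q [oV oQ Vp Qq VQ]]] := open_prod_box (cts_open_gt (e / 2) cnF) pq.
have UV : U (x @^-1` V) by apply: xp; apply: open_nbhs_nbhs.
have UQ : U (t @^-1` Q) by apply: tq; apply: open_nbhs_nbhs.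
have [n /= Qn] := filter_ex UQ.
have [m [/= Vm nm]] := filter_ex (filterI UV (UN n.+1)).
have /= := VQ (x m, t n) (conj Vm Qn).
by rewrite ltNge (ltW (off _ _ nm)).
Qed.

End DoubleLimit.

(** * Compactly supported measures *)

Section CompactlySupported.
Variables (R : realType) (X : topologicalType).
Local Notation bX := (stone_cech R X).
Local Notation emb := (@sc_embed R X).
Local Notation P := (radon_probability R bX).
Local Notation Y := (set_type (@P_beta R X)).

Let hB : hausdorff_space bX := @stone_cech_hausdorff R X.
Let cB : compact [set: bX] := @stone_cech_compact R X.

Definition pb_integral (f : bX -> R) (y : Y) : R := rp_integral f (set_val y).

Lemma pb_integral_state (y : Y) : state (fun f : bX -> R => pb_integral f y).
Proof. exact: rp_state. Qed.

Lemma P_beta_cvgP (F : set_system Y) (y : Y) : Filter F ->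
  F --> y <-> forall f : bX -> R, continuous f -> pb_integral f @ F --> pb_integral f y.
Proof.
move=> FF; rewrite set_type_cvgP; split=> [Fy f cf|Fy].
  exact: ((proj1 (@rp_cvgP R bX (set_val @ F) (set_val y) _)) Fy f cf).
by apply/rp_cvgP => f cf; exact: (Fy f cf).
Qed.

Lemma P_beta_nbhsP (y : Y) (V : set Y) : nbhs y V ->
  exists (I : finType) (f : I -> bX -> R) (e : R),
    [/\ 0 < e, forall i, continuous (f i) &
     forall z, (forall i, `|pb_integral (f i) z - pb_integral (f i) y| < e) -> V z].
Proof.
move=> /set_type_nbhs [B /rp_nbhsP [I [f [e [e0 cf fB]]]] BV].
by exists I, f, e; split => // z zy; apply: BV; apply: fB.
Qed.

Lemma cvg_to_P_beta (S : topologicalType) (g : S -> Y) (s : S) :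
  (forall f : bX -> R, continuous f ->
    (fun t => pb_integral f (g t)) @ s --> pb_integral f (g s)) -> g @ s --> g s.
Proof. by move=> H; apply/P_beta_cvgP. Qed.

(** Weak neighbourhoods see integrals only. Thanks to this, equality of elements of [Y] as records
    never has to be proved. *)
Lemma eq_pb_integral (f : Y -> R) (y z : Y) : continuous f ->
  (forall h : bX -> R, continuous h -> pb_integral h y = pb_integral h z) -> f y = f z.
Proof.
move=> cf yz; apply/eqP; rewrite -subr_eq0 -normr_eq0 -[_ == _]negbK.
apply/negP; rewrite normr_eq0 -normr_gt0 => d0.
have /cvgrPdist_lt /(_ _ d0) := cf y.
move=> /P_beta_nbhsP [I [h [e [e0 ch H]]]].
suff : `|f y - f z| < `|f y - f z| by rewrite ltxx.
by apply: H => i; rewrite yz// subrr normr0.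
Qed.

Definition concentrated (K : set X) : set Y :=
  [set y | rp_measure (set_val y) (emb @` K) = 1%E].

Lemma compact_concentrated (K : set X) : compact K -> compact (concentrated K).
Proof.
move=> cK.
apply: (@compact_set_type _ (@P_beta R X)
  [set mu : P | rp_measure mu (emb @` K) = 1%E]).
  by apply: concentrated_compact => //; exact: sc_embed_closed.
by move=> mu muK; exists K.
Qed.

Lemma concentrated_integralP (K : set X) (y : Y) : compact K ->
  concentrated K y <-> forall f : bX -> R, continuous f ->
    (forall z, 0 <= f z <= 1) -> (forall x, K x -> f (emb x) = 1) -> pb_integral f y = 1.
Proof.
move=> cK; have cE : closed (emb @` K) by exact: sc_embed_closed.
split=> [|H].
  move=> /(concentratedP hB cB _ cE) H f cf f01 f1; apply: H => //.
  by move=> _ [x Kx <-]; exact: f1.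
apply/(concentratedP hB cB _ cE) => f cf f01 f1; apply: H => // x Kx.
by apply: f1; exists x.
Qed.

(** The source of all elements constructed in [Y]: atomic measures and mixtures are written down as
    states and realized by the Riesz theorem. *)
Lemma state_in_P_beta (L : (bX -> R) -> R) (K : set X) : state L -> compact K ->
  (forall f : bX -> R, continuous f -> (forall z, 0 <= f z <= 1) ->
    (forall x, K x -> f (emb x) = 1) -> L f = 1) ->
  exists y : Y, forall f : bX -> R, continuous f -> pb_integral f y = L f.
Proof.
move=> sL cK LK; have [mu muL] := riesz_radon hB cB sL.
have cE : closed (emb @` K) by exact: sc_embed_closed.
have muY : mu \in @P_beta R X.
  apply/mem_set; exists K; split => //.
  apply/(concentratedP hB cB _ cE) => f cf f01 f1; rewrite muL//.
  by apply: LK => // x Kx; apply: f1; exists x.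
by exists (SigSub muY) => f cf; rewrite /pb_integral /= muL.
Qed.

Lemma P_beta_concentrated (y : Y) : exists2 K : set X, compact K & concentrated K y.
Proof. by have [K [cK yK]] := set_valP y; exists K. Qed.

Definition atomic_state (I : finType) (w : I -> R) (x : I -> X) (f : bX -> R) : R :=
  \sum_i w i * f (emb (x i)).

Definition weights (I : finType) (w : I -> R) :=
  (forall i, 0 <= w i) /\ \sum_i w i = 1.

Lemma atomic_stateP (I : finType) (w : I -> R) (x : I -> X) : weights w ->
  state (atomic_state w x).
Proof.
move=> [w0 w1]; split; rewrite /atomic_state.
- move=> f g _ _; rewrite -big_split; apply: eq_bigr => i _; exact: mulrDr.
- move=> a f _; rewrite mulr_sumr; apply: eq_bigr => i _; exact: mulrCA.
- by move=> f _ f0; apply: sumr_ge0 => i _; exact: mulr_ge0.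
- by under eq_bigr do rewrite mulr1.
Qed.

Lemma compact_range_fintype (I : finType) (x : I -> X) : compact (range x).
Proof.
by apply: finite_compact; apply: finite_image; exact: finite_finset.
Qed.

Lemma atomic_exists (I : finType) (w : I -> R) (x : I -> X) : weights w ->
  exists y : Y, forall f : bX -> R, continuous f -> pb_integral f y = atomic_state w x f.
Proof.
move=> ww; apply: (@state_in_P_beta _ (range x) (atomic_stateP x ww)).
  exact: compact_range_fintype.
move=> f cf _ f1; rewrite /atomic_state; case: ww => _ <-.
by apply: eq_bigr => i _; rewrite f1 ?mulr1//; exists i.
Qed.

Definition mixture_state (t : R) (y z : Y) (f : bX -> R) : R :=
  t * pb_integral f y + (1 - t) * pb_integral f z.

Lemma mixture_exists (t : R) (y z : Y) : 0 <= t <= 1 ->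
  exists u : Y, forall f : bX -> R, continuous f -> pb_integral f u = mixture_state t y z f.
Proof.
case/andP=> t0 t1; have [K cK yK] := P_beta_concentrated y; have [C cC zC] := P_beta_concentrated z.
have t1' : 0 <= 1 - t by rewrite subr_ge0.
apply: (@state_in_P_beta _ (K `|` C)); last 2 first.
- exact: compactU.
- move=> f cf f01 f1; rewrite /mixture_state.
  rewrite ((concentrated_integralP _ cK).1 yK f)//; last by move=> x Kx; apply: f1; left.
  rewrite ((concentrated_integralP _ cC).1 zC f)//; last by move=> x Kx; apply: f1; right.
  by rewrite !mulr1 addrC subrK.
have sy := pb_integral_state y; have sz := pb_integral_state z.
split; rewrite /mixture_state.
- by move=> f g cf cg; rewrite (stateD sy)// (stateD sz)//; ring.
- by move=> a f cf; rewrite (stateZ sy)// (stateZ sz)//; ring.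
- move=> f cf f0; apply: addr_ge0; apply: mulr_ge0 => //.
    exact: (state_ge0 sy).
  exact: (state_ge0 sz).
- by rewrite (state_cst sy) (state_cst sz); ring.
Qed.

Variable x0 : X.

Lemma P_beta_inhabited : exists y : Y, True.
Proof.
have w1 : weights (fun _ : unit => 1 : R).
  by split => [_|]; rewrite ?ler01// big_const card_unit /= addr0.
by have [y _] := atomic_exists (fun=> x0) w1; exists y.
Qed.

(* Only the integrals of the chosen element are used: keeping the choice opaque
   prevents it from being unfolded during unification. *)
Lemma P_beta_of_subproof : {P_beta_of : ((bX -> R) -> R) -> Y |
  forall (L : (bX -> R) -> R) (f : bX -> R),
    (exists y : Y, forall g : bX -> R, continuous g -> pb_integral g y = L g) ->
    continuous f -> pb_integral f (P_beta_of L) = L f}.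
Proof.
exists (fun L => xget (sval (cid P_beta_inhabited))
  [set y | forall f : bX -> R, continuous f -> pb_integral f y = L f]).
move=> L f [y yL]; case: xgetP => [z _ zL|/(_ y)//]; exact: zL.
Qed.

Definition P_beta_of (L : (bX -> R) -> R) : Y := sval P_beta_of_subproof L.

Lemma P_beta_ofE (L : (bX -> R) -> R) (f : bX -> R) :
  (exists y : Y, forall f : bX -> R, continuous f -> pb_integral f y = L f) ->
  continuous f -> pb_integral f (P_beta_of L) = L f.
Proof. exact: (svalP P_beta_of_subproof). Qed.

Definition atomic (I : finType) (w : I -> R) (x : I -> X) : Y := P_beta_of (atomic_state w x).
Definition mixture (t : R) (y z : Y) : Y := P_beta_of (mixture_state t y z).
Definition dirac_at (x : X) : Y := atomic (fun _ : unit => 1) (fun=> x).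

Lemma atomicE (I : finType) (w : I -> R) (x : I -> X) (f : bX -> R) : weights w ->
  continuous f -> pb_integral f (atomic w x) = \sum_i w i * f (emb (x i)).
Proof. by move=> ww cf; rewrite P_beta_ofE//; exact: atomic_exists. Qed.

Lemma mixtureE t y z (f : bX -> R) : 0 <= t <= 1 -> continuous f ->
  pb_integral f (mixture t y z) = t * pb_integral f y + (1 - t) * pb_integral f z.
Proof. by move=> t01 cf; rewrite P_beta_ofE//; exact: mixture_exists. Qed.

Lemma dirac_atE x (f : bX -> R) : continuous f -> pb_integral f (dirac_at x) = f (emb x).
Proof.
move=> cf; rewrite atomicE//; first by rewrite big_const card_unit /= addr0 mul1r.
by split => [_|]; rewrite ?ler01// big_const card_unit /= addr0.
Qed.

Lemma atomic_concentrated (I : finType) (w : I -> R) (x : I -> X) (K : set X) :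
  weights w -> compact K -> (forall i, K (x i)) -> concentrated K (atomic w x).
Proof.
move=> ww cK Kx; apply/concentrated_integralP => // f cf f01 f1; rewrite atomicE//.
by case: ww => _ <-; apply: eq_bigr => i _; rewrite f1 ?mulr1.
Qed.

Lemma atomic_dist (I : finType) (w : I -> R) (x z : I -> X) (f : bX -> R) e :
  weights w -> continuous f ->
  (forall i, `|f (emb (z i)) - f (emb (x i))| <= e) ->
  `|pb_integral f (atomic w z) - pb_integral f (atomic w x)| <= e.
Proof.
move=> ww cf fe; rewrite !atomicE// -sumrB; case: ww => w0 w1.
apply: (le_trans (ler_norm_sum _ _ _)).
apply: (@le_trans _ _ (\sum_i w i * e)); last by rewrite -mulr_suml w1 mul1r.
apply: ler_sum => i _; rewrite -mulrBr normrM ger0_norm//.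
exact: ler_wpM2l.
Qed.

(** [V] is controlled by finitely many integrands. If each atom moves so little that all of them
    vary by less than [e / 2] there, their weighted averages vary by at most [e / 2]. *)
Lemma atomic_perturb (I : finType) (w : I -> R) (x : I -> X) (V : set Y) :
  weights w -> nbhs (atomic w x) V -> exists U : I -> set X,
    (forall i, open (U i) /\ U i (x i)) /\
    forall z, (forall i, U i (z i)) -> V (atomic w z).
Proof.
move=> ww /P_beta_nbhsP [J [f [e [e0 cf fV]]]].
have e2 : 0 < e / 2 by rewrite divr_gt0.
exists (fun i => [set u | forall j : J, `|f j (emb u) - f j (emb (x i))| < e / 2]°).
split=> [i|z Uz].
  split; first exact: open_interior.
  apply: filter_forall => j.
  have cfe : continuous (fun u => f j (emb u)).
    move=> u; apply: (@continuous_comp _ _ _ emb (f j)); last exact: cf.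
    exact: sc_embed_continuous.
  have /cvgrPdist_lt /(_ _ e2) := cfe (x i).
  by apply: filterS => u; rewrite distrC.
apply: fV => j; apply: (@le_lt_trans _ _ (e / 2)); last lra.
apply: atomic_dist => // i; apply: ltW.
by exact: (interior_subset (Uz i)).
Qed.

End CompactlySupported.

(** * Finite nets and partitions of unity *)

Section NetPartition.
Variables (R : realType) (Z : topologicalType) (d : Z -> Z -> R).
Hypotheses (d0 : forall x, d x x = 0) (dsym : forall x y, d x y = d y x)
  (dtri : forall x y z, d x z <= d x y + d y z)
  (dnear : forall x e, 0 < e -> nbhs x [set z | d z x < e]).

Lemma pob_finite_net (e : R) : pseudo_omega_bounded Z -> 0 < e ->
  exists n (b : 'I_n -> Z), forall z, exists i, d z (b i) < e.
Proof.
move=> pobZ e0; have [s Hs] := pob_totally_bounded dsym dtri dnear d0 pobZ e0.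
exists (size s), (tnth (in_tuple s)) => z; have [b bs zb] := Hs z.
by have /tnthP [i bi] : b \in in_tuple s by []; exists i; rewrite -bi.
Qed.

Lemma pseudometric_continuous b : continuous (fun z => d z b).
Proof.
move=> z; apply/cvgrPdist_lt => e e0; have := dnear z e0.
apply: filterS => y /= yz; rewrite ltr_norml; apply/andP; split.
  by have := dtri y z b; rewrite /= in yz *; lra.
by have := dtri z y b; rewrite (dsym z y) /= in yz *; lra.
Qed.

(** The tent functions [h i] around the points of the net are divided by their sum, which is
    positive because the balls cover [Z]. *)
Lemma net_partition (e : R) (I : finType) (b : I -> Z) :
  (forall z, exists i, d z (b i) < e) ->
  exists psi : I -> Z -> R, [/\ forall i, continuous (psi i),
    forall i z, 0 <= psi i z, forall z, \sum_i psi i z = 1 &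
    forall i z, psi i z != 0 -> d z (b i) < e].
Proof.
move=> Hb; pose h i z := Num.max 0 (e - d z (b i)).
have h0 i z : 0 <= h i z by rewrite le_max lexx.
have ch i : continuous (h i).
  apply: cts_max; first exact: ctsC.
  by apply: ctsB; [exact: ctsC|exact: pseudometric_continuous].
pose s z := \sum_i h i z.
have cs : continuous s by exact: cts_sum.
have s0 z : 0 < s z.
  have [i zi] := Hb z; rewrite /s (bigD1 i)//=; apply: ltr_wpDr.
    by apply: sumr_ge0 => j _.
  by rewrite lt_max subr_gt0 zi orbT.
exists (fun i z => h i z / s z); split.
- by move=> i; apply: ctsM => //; apply: ctsV => // z; rewrite gt_eqF.
- by move=> i z; apply: divr_ge0 => //; exact: ltW.
- by move=> z; rewrite -mulr_suml -/(s z) divff// gt_eqF.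
- move=> i z; rewrite mulf_eq0 negb_or => /andP[hn _].
  rewrite ltNge; apply/negP => ed; move: hn; rewrite /h.
  by rewrite (max_idPl _) ?eqxx// subr_le0.
Qed.

End NetPartition.

(** * Density of finitely supported measures, and its consequences *)

Section Density.
Variables (R : realType) (X : topologicalType) (x0 : X).
Local Notation bX := (stone_cech R X).
Local Notation emb := (@sc_embed R X).
Local Notation P := (radon_probability R bX).
Local Notation Y := (set_type (@P_beta R X)).
Let cB : compact [set: bX] := @stone_cech_compact R X.

(** The integrands [f j] define a continuous pseudometric on [bX]. For a partition of unity [psi]
    subordinate to small balls centred at points [b i] of [X], the weights are the integrals of
    [psi i]: each [f j] is within [e / 2] of the sum of the [f j (emb (b i)) * psi i]. *)
Lemma atomic_dense (mu : P) (A : set P) : nbhs mu A ->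
  exists (I : finType) (w : I -> R) (x : I -> X),
    weights w /\ A (set_val (atomic x0 w x)).
Proof.
move=> /rp_nbhsP [J [f [e [e0 cf fA]]]].
pose d (z z' : bX) := \sum_j `|f j z - f j z'|.
have dd z : d z z = 0 by apply: big1 => j _; rewrite subrr normr0.
have dsym z z' : d z z' = d z' z by apply: eq_bigr => j _; exact: distrC.
have dtri x y z : d x z <= d x y + d y z.
  by rewrite -big_split; apply: ler_sum => j _; exact: ler_distD.
have dnear z a : 0 < a -> nbhs z [set z' | d z' z < a].
  move=> a0; have cd : continuous (fun z' => d z' z).
    apply: cts_sum => j; apply: cts_norm; apply: ctsB => //; exact: ctsC.
  apply: open_nbhs_nbhs; split; first exact: cts_open_lt.
  by rewrite /= dd.
have e4 : 0 < e / 4 by rewrite divr_gt0.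
have [n [c Hc]] := pob_finite_net dd dsym dtri dnear (compact_pob cB) e4.
(* The centres of the net are moved into the dense image of [X], at the price of doubling the radius
   [e / 4]. *)
have [b Hb] := choice (fun i => sc_embed_dense (dnear (c i) _ e4)).
have [|psi [cpsi psi0 psi1 psid]] :=
    @net_partition R bX d dsym dtri dnear (e / 2) _ (emb \o b).
  move=> z; have [i zi] := Hc z; exists i => /=.
  have := dtri z (c i) (emb (b i)); have := Hb i; rewrite /= (dsym (c i)).
  lra.
pose w i := rp_integral (psi i) mu.
have sm := rp_state cB mu.
have ww : weights w.
  split; first by move=> i; exact: (state_ge0 sm).
  rewrite -(state_sum sm)//.
  rewrite (_ : (fun _ => _) = fun=> 1); first exact: (state_cst sm).
  by apply/funext => z; rewrite psi1.
exists 'I_n, w, b; split => //; apply: fA => j.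
rewrite -[rp_integral (f j) (set_val _)]/(pb_integral (f j) (atomic x0 w b)) atomicE//.
have cpf i : continuous (fun z => f j (emb (b i)) * psi i z).
  by apply: ctsM => //; exact: ctsC.
have -> : \sum_i w i * f j (emb (b i)) =
    rp_integral (fun z => \sum_i f j (emb (b i)) * psi i z) mu.
  rewrite (state_sum sm)//; apply: eq_bigr => i _.
  by rewrite (stateZ sm)// mulrC.
apply: (@le_lt_trans _ _ (e / 2)); last lra.
apply: (state_dist sm) => //; first exact: cts_sum.
move=> z; rewrite -[f j z]mulr1 -(psi1 z) mulr_sumr -sumrB.
apply: (le_trans (ler_norm_sum _ _ _)).
apply: (@le_trans _ _ (\sum_i e / 2 * psi i z)); last by rewrite -mulr_sumr psi1 mulr1.
apply: ler_sum => i _; rewrite -mulrBl normrM (ger0_norm (psi0 i z)).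
have [->|pn0] := eqVneq (psi i z) 0; first by rewrite !mulr0.
apply: ler_wpM2r => //; apply: ltW; apply: le_lt_trans (psid i z pn0).
rewrite dsym /d (bigD1 j)//= lerDl; exact: sumr_ge0.
Qed.

Lemma atomic_dense_P_beta (y : Y) (A : set Y) : nbhs y A ->
  exists (I : finType) (w : I -> R) (x : I -> X), weights w /\ A (atomic x0 w x).
Proof.
move=> /set_type_nbhs [B /atomic_dense [I [w [x [ww Bx]]]] BA].
by exists I, w, x; split => //; exact: BA.
Qed.

Lemma pb_integral_continuous (f : bX -> R) : continuous f ->
  continuous (pb_integral f : Y -> R).
Proof.
move=> cf y; apply: (@continuous_comp _ _ _ set_val (rp_integral f)).
  exact: set_val_continuous.
exact: rp_integral_continuous.
Qed.

Lemma cts_emb (f : bX -> R) : continuous f -> continuous (f \o emb).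
Proof.
move=> cf u; apply: (@continuous_comp _ _ _ emb f); last exact: cf.
exact: sc_embed_continuous.
Qed.

Local Notation I01 := (set_type (`[0, 1]%classic : set R)).

Lemma I01P (t : I01) : 0 <= set_val t <= 1.
Proof. by have := set_valP t; rewrite /= in_itv. Qed.

Lemma I01_pob : pseudo_omega_bounded I01.
Proof.
apply: compact_pob.
have -> : [set: I01] = set_val @^-1` (`[0, 1]%classic : set R).
  by apply/seteqP; split => // t _; exact: set_valP.
by apply: compact_set_type => //; exact: segment_compact.
Qed.

Lemma mixture_continuous (S : topologicalType) (t : S -> R) (y z : S -> Y) :
  continuous t -> continuous y -> continuous z -> (forall s, 0 <= t s <= 1) ->
  continuous (fun s => mixture x0 (t s) (y s) (z s)).
Proof.
move=> ct cy cz t01 s; apply: cvg_to_P_beta => f cf.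
rewrite (_ : (fun _ => _) =
  fun s => t s * pb_integral f (y s) + (1 - t s) * pb_integral f (z s)); last first.
  by apply/funext => r; rewrite mixtureE.
rewrite mixtureE//.
have cyf : continuous (fun s => pb_integral f (y s)).
  move=> r; apply: (@continuous_comp _ _ _ y (pb_integral f)); first exact: cy.
  exact: pb_integral_continuous.
have czf : continuous (fun s => pb_integral f (z s)).
  move=> r; apply: (@continuous_comp _ _ _ z (pb_integral f)); first exact: cz.
  exact: pb_integral_continuous.
apply: (ctsD (f := fun s => t s * pb_integral f (y s))).
  exact: ctsM.
by apply: ctsM => //; apply: ctsB => //; exact: ctsC.
Qed.

Lemma dirac_at_continuous : continuous (fun x => dirac_at R x0 x : Y).
Proof.
move=> x; apply: cvg_to_P_beta => f cf.
rewrite (_ : (fun _ => _) = f \o emb); last first.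
  by apply/funext => u; rewrite dirac_atE.
by rewrite dirac_atE//; exact: cts_emb.
Qed.

Lemma pob_P_beta : pseudo_omega_bounded X -> pseudo_omega_bounded Y.
Proof.
move=> pX U HU.
have H1 n : exists r : {I : finType & ((I -> R) * (I -> X))%type},
    weights (projT2 r).1 /\ U n (atomic x0 (projT2 r).1 (projT2 r).2).
  have [oU [y Uy]] := HU n.
  have [|I [w [x [ww Ux]]]] := @atomic_dense_P_beta y (U n).
    by apply: open_nbhs_nbhs; split.
  by exists (existT _ I (w, x)).
have [r Hr] := choice H1.
pose I n := projT1 (r n); pose w n : I n -> R := (projT2 (r n)).1.
pose x n : I n -> X := (projT2 (r n)).2.
have H2 n : exists V : I n -> set X, (forall i, open (V i) /\ V i (x n i)) /\
    forall z, (forall i, V i (z i)) -> U n (atomic x0 (w n) z).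
  have [ww Ux] := Hr n; apply: atomic_perturb => //; apply: open_nbhs_nbhs.
  by split=> //; case: (HU n).
have {}H2 := fun n => cid (H2 n); pose V n := sval (H2 n).
have VP n := svalP (H2 n).
(* One compact set for the neighbourhoods of all atoms of all the chosen measures. *)
have [|K [cK VK]] := @pob_countable X {n : nat & I n}
    (fun j => V (projT1 j) (projT2 j)) pX.
  by move=> [n i] /=; have [/(_ i) [oV Vx] _] := VP n; split => //; exists (x n i).
exists (concentrated K); split; first exact: compact_concentrated.
move=> n; have [z Hz] := choice (fun i => VK (existT _ n i)).
exists (atomic x0 (w n) z); split.
  by apply: (VP n).2 => i; case: (Hz i).
apply: atomic_concentrated => //; first by case: (Hr n).
by move=> i; case: (Hz i).
Qed.

End Density.

(** * Necessity of pseudo-omega-boundedness *)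

Lemma bounded_fun_le (R : realType) (Z : Type) (f : Z -> R) :
  bounded_fun f <-> exists M, forall z, `|f z| <= M.
Proof.
split=> [[M [_ H]]|[M H]]; first by exists (M + 1) => z; apply: H => //; rewrite ltrDl.
exists M; split; first exact: num_real.
by move=> y My z _; exact: le_trans (H z) (ltW My).
Qed.

Lemma pob_pseudocompact (R : realType) (Z : topologicalType) :
  pseudo_omega_bounded Z -> pseudocompact R Z.
Proof.
move=> pZ f cf; apply/bounded_fun_le; apply: contrapT => nb.
have [|K [cK VK]] := pZ (fun n => [set z | n%:R < `|f z|]).
  move=> n; split; first by apply: cts_open_gt; exact: cts_norm.
  apply: contrapT => nz; apply: nb; exists n%:R => z.
  by rewrite leNgt; apply/negP => fz; apply: nz; exists z.
have : compact (f @` K).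
  by apply: continuous_compact => //; exact: continuous_subspaceT.
move=> /compact_bounded [M [_ /(_ (M + 1))]] H.
have {}H z : K z -> `|f z| <= M + 1 by move=> Kz; apply: H; [rewrite ltrDl|exists z].
have [z [/= zn Kz]] := VK (Num.truncn (M + 1)).+1.
have := lt_le_trans zn (H z Kz); rewrite ltNge ltW// truncnS_gt//.
Qed.

(** From index [N] on all terms are at most [e], so up to [e] only the first [N] functions matter,
    and these vary little near [s]. *)
Lemma sup_weighted_continuous (R : realType) (S : topologicalType)
    (q : nat -> S -> R) :
  (forall i, continuous (q i)) -> (forall i s, 0 <= q i s <= 1) ->
  continuous (fun s => sup (range (fun i => q i s / i.+1%:R))).
Proof.
move=> cq q01; set h := fun s => _.
have hub s : has_ubound (range (fun i => q i s / i.+1%:R)).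
  exists 1 => _ [i _ <-]; case/andP: (q01 i s) => q0 q1.
  by rewrite ler_pdivrMr ?ltr0n// mul1r (le_trans q1)// ler1n.
have leh i s : q i s / i.+1%:R <= h s by apply: ub_le_sup => //; exists i.
have hle s c : (forall i, q i s / i.+1%:R <= c) -> h s <= c.
  by move=> H; apply: ge_sup => [|_ [i _ <-]//]; exists (q 0%N s / 1%:R), 0%N.
move=> s; apply/cvgrPdist_le => e e0.
pose N := (Num.truncn e^-1).+1.
have Ne i : (N <= i)%N -> i.+1%:R^-1 <= e.
  move=> Ni; rewrite invf_ple ?posrE ?ltr0n//.
  apply: (le_trans (ltW (truncnS_gt _))); rewrite ler_nat.
  exact: (leq_trans Ni).
have : \forall t \near s, forall i : 'I_N, `|q i s - q i t| <= e.
  apply: filter_forall => i.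
  by have /cvgrPdist_le /(_ _ e0) := cq i s.
apply: filterS => t H.
have key a b : (forall i : 'I_N, `|q i a - q i b| <= e) -> h a <= h b + e.
  move=> ab; apply: hle => i; case/andP: (q01 i a) => qa0 qa1.
  have i1 : i.+1%:R^-1 <= 1 :> R by rewrite invf_le1 ?ltr0n// ler1n.
  have i0 : 0 <= i.+1%:R^-1 :> R by rewrite invr_ge0 ler0n.
  have hb := leh i b; case/andP: (q01 i b) => qb0 qb1.
  have [Ni|iN] := leqP N i.
    apply: (@le_trans _ _ e); last by rewrite lerDr (le_trans _ hb)// mulr_ge0.
    by apply: le_trans (Ne i Ni); rewrite ler_piMl.
  have qab : q i a <= q i b + e.
    by have := ab (Ordinal iN); rewrite ler_distlC /= => /andP[]; lra.
  apply: (@le_trans _ _ ((q i b + e) / i.+1%:R)); first exact: ler_wpM2r.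
  rewrite mulrDl; apply: lerD => //.
  by rewrite ler_piMr// ltW.
have h1 := key s t H.
have h2 : h t <= h s + e by apply: key => i; rewrite distrC.
by rewrite ler_norml; apply/andP; split; lra.
Qed.

(** * Bump functions and a positive function with infimum zero *)

Section Vanishing.
Variables (R : realType) (X : topologicalType).
Hypothesis crX : completely_regular_space X.
Local Notation bX := (stone_cech R X).
Local Notation emb := (@sc_embed R X).
Local Notation P := (radon_probability R bX).
Local Notation Y := (set_type (@P_beta R X)).
Let cB : compact [set: bX] := @stone_cech_compact R X.

Lemma bump (U : set X) (x : X) : open U -> U x ->
  exists f : bX -> R, [/\ continuous f, forall z, 0 <= f z <= 1,
    f (emb x) = 1 & forall u, ~ U u -> f (emb u) = 0].
Proof.
move=> oU Ux.
have := @crX x (~` U) (open_closedC oU) (fun n => n Ux).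
move=> /(@uniform_separatorP _ R) [f [cf f01 f0 f1]].
have f01' u : 0 <= f u <= 1.
  by have := f01 (f u); rewrite /= in_itv; apply; exists u.
have [||g [cg g01 gf]] := @sc_extend01 R X (fun u => 1 - f u).
- by apply: ctsB => //; exact: ctsC.
- by move=> u; case/andP: (f01' u) => ? ?; apply/andP; split; lra.
exists g; split => // [|u nU]; rewrite gf.
  by rewrite (f0 (f x)) ?subr0//; exists x.
by rewrite (f1 (f u)) ?subrr//; exists u.
Qed.

(* The last atom takes the remaining mass, so that the [i]-th weight is at least
   [2^-(i+1)] independently of [n]. *)
Lemma sum_geometric_last n : \sum_(j < n.+1)
   (if (j < n)%N then 2^-1 ^+ j.+1 else 2^-1 ^+ n) = 1 :> R.
Proof.
rewrite big_ord_recr/= ltnn.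
rewrite (eq_bigr (fun j : 'I_n => 2^-1 ^+ j.+1)); last by move=> j _; rewrite ltn_ord.
elim: n => [|n IH]; first by rewrite big_ord0 add0r expr0.
rewrite big_ord_recr/= -[RHS]IH -addrA; congr (_ + _).
by rewrite exprS; lra.
Qed.

(** [q i] is [1] where the integral of the bump [f i] vanishes and [0] where it is at least [a i];
    [h] is the supremum of the [q i / i.+1]. A measure on a compact [K] missing [U n] has [q n = 1].
    A measure with mass at least [a i] at [x i] for all [i <= n] kills the first terms, and the
    others are at most [1/(n+1)]. *)
Lemma vanishing_function : ~ pseudo_omega_bounded X ->
  exists (x0 : X) (h : P -> R), [/\ continuous h, forall y : Y, 0 < h (set_val y) &
    forall n, exists y : Y, h (set_val y) <= n.+1%:R^-1].
Proof.
move=> npX.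
have [U [HU nK]] : exists U : nat -> set X, (forall n, open (U n) /\ U n !=set0) /\
    forall K, compact K -> exists n, U n `&` K = set0.
  apply: contrapT => nU; apply: npX => U HU; apply: contrapT => nK; apply: nU.
  exists U; split => // K cK; apply: contrapT => nn; apply: nK; exists K.
  split => // n; apply/set0P/negP => /eqP UK; apply: nn; by exists n.
have Ux n : exists x, U n x by case: (HU n).
have [x Hx] := choice Ux.
have [f Hf] := choice (fun n => bump (HU n).1 (Hx n)).
pose a i : R := 2^-1 ^+ i.+1.
have a0 i : 0 < a i by rewrite exprn_gt0// invr_gt0.
pose q i (mu : P) := Num.min 1 (Num.max 0 (1 - rp_integral (f i) mu / a i)).
have cq i : continuous (q i).
  apply: cts_min; first exact: ctsC.
  apply: cts_max; first exact: ctsC.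
  apply: ctsB; first exact: ctsC.
  apply: ctsM; last exact: ctsC.
  by apply: rp_integral_continuous; case: (Hf i).
have q01 i mu : 0 <= q i mu <= 1.
  by rewrite /q ge_min lexx le_min ler01 le_max lexx.
have hub mu : has_ubound (range (fun i => q i mu / i.+1%:R)).
  exists 1 => _ [i _ <-]; case/andP: (q01 i mu) => q0 q1.
  by rewrite ler_pdivrMr ?ltr0n// mul1r (le_trans q1)// ler1n.
exists (x 0%N), (fun mu => sup (range (fun i => q i mu / i.+1%:R))); split.
- exact: sup_weighted_continuous.
- move=> y; have [K cK yK] := P_beta_concentrated y; have [n UnK] := nK K cK.
  have [cf f01 f1 f0] := Hf n.
  have yn : pb_integral (f n) y = 0.
    have := (concentrated_integralP y cK).1 yK (fun z => 1 - f n z).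
    rewrite (stateB (pb_integral_state y))//; last exact: ctsC.
    rewrite (state_cst (pb_integral_state y)) => H.
    suff : 1 - pb_integral (f n) y = 1 by lra.
    apply: H; first by apply: ctsB => //; exact: ctsC.
      by move=> z; case/andP: (f01 z) => ? ?; apply/andP; split; lra.
    move=> u Ku; rewrite f0 ?subr0// => Unu.
    by have : (U n `&` K) u by []; rewrite UnK.
  apply: (@lt_le_trans _ _ (q n (set_val y) / n.+1%:R)).
    rewrite divr_gt0 ?ltr0n// /q -/(pb_integral (f n) y) yn mul0r subr0.
    by rewrite lt_min ltr01 lt_max ltr01 orbT.
  by apply: ub_le_sup => //; exists n.
- move=> n; pose w (j : 'I_n.+2) : R :=
    if (j < n.+1)%N then 2^-1 ^+ j.+1 else 2^-1 ^+ n.+1.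
  have wa (j : 'I_n.+2) : a j <= w j.
    rewrite /w /a; case: ifPn => // nj; rewrite -leqNgt in nj.
    by apply: ler_wiXn2l => //; [rewrite invf_le1//; lra|exact: leqW].
  have ww : weights w.
    split; last exact: sum_geometric_last.
    by move=> j; apply: le_trans (wa j); exact: ltW.
  exists (atomic (x 0%N) w (fun j => x j)).
  apply: ge_sup; first by eexists; exists 0%N.
  move=> _ [i _ <-]; have [ni|ni] := ltnP n i.
    apply: (@le_trans _ _ (i.+1%:R^-1)).
      by case/andP: (q01 i (set_val (atomic (x 0%N) w (fun j => x j)))) => ? ?;
        rewrite ler_piMl// invr_ge0 ler0n.
    by rewrite lef_pV2 ?posrE ?ltr0n// ler_nat ltnW.
  have -> : q i (set_val (atomic (x 0%N) w (fun j => x j))) = 0.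
    have [cf f01 f1 f0] := Hf i.
    rewrite /q -/(pb_integral (f i) (atomic (x 0%N) w (fun j => x j))) atomicE//.
    have H : a i <= \sum_j w j * f i (emb (x j)).
      have iN : (i < n.+2)%N by rewrite ltnS ltnW.
      rewrite (bigD1 (Ordinal iN))//= f1 mulr1; apply: ler_wpDr.
        apply: sumr_ge0 => j _; apply: mulr_ge0; first by case: ww.
        by case/andP: (f01 (emb (x j))).
      exact: (wa (Ordinal iN)).
    rewrite (max_idPl _) ?(min_idPr _)//.
    by rewrite subr_le0 ler_pdivlMr// mul1r.
  by rewrite mul0r invr_ge0 ler0n.
Qed.

Lemma pseudocompact_P_beta_pob : pseudocompact R Y -> pseudo_omega_bounded X.
Proof.
move=> pcY; apply: contrapT => /vanishing_function [_ [h [ch h0 hn]]].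
have chY : continuous (fun y : Y => h (set_val y)).
  move=> y; apply: (@continuous_comp _ _ _ set_val h); last exact: ch.
  exact: set_val_continuous.
have /bounded_fun_le [M HM] : bounded_fun (fun y : Y => (h (set_val y))^-1).
  by apply: pcY; apply: ctsV => // y; exact: lt0r_neq0.
have [y Hy] := hn (Num.truncn M).
have := HM y; rewrite gtr0_norm ?invr_gt0// leNgt => /negP; apply.
apply: (lt_le_trans (truncnS_gt M)).
by rewrite -[leLHS]invrK lef_pV2 ?posrE ?invr_gt0 ?ltr0n.
Qed.

End Vanishing.

(** Basic weak neighbourhoods are convex. *)
Lemma convex_dist_lt (R : realType) (s x y a e : R) : 0 <= s <= 1 ->
  `|x - a| < e -> `|y - a| < e -> `|s * x + (1 - s) * y - a| < e.
Proof.
move=> /andP[s0 s1] xa ya; apply: (@le_lt_trans _ _ (Num.max `|x - a| `|y - a|)).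
  have : `|x - a| <= Num.max `|x - a| `|y - a| by rewrite le_max lexx.
  have : `|y - a| <= Num.max `|x - a| `|y - a| by rewrite le_max lexx orbT.
  move: (Num.max _ _) => m; rewrite !ler_norml => /andP[? ?] /andP[? ?].
  by apply/andP; split; nra.
by rewrite gt_max xa.
Qed.

Section CstarEmbedded.
Variables (R : realType) (X : topologicalType).
Local Notation bX := (stone_cech R X).
Local Notation P := (radon_probability R bX).
Local Notation Y := (set_type (@P_beta R X)).

Lemma sin_peak k : sin (pi / 2 + (pi *+ 2) *+ k) = 1 :> R.
Proof. by rewrite (periodicn (@sinD2pi R)) sin_pihalf. Qed.

(** Let [g] extend [sin (1/h)] and let [mu] be a limit of measures [y n] with [h] tending to [0]. A
    convex neighbourhood of [mu] on which [g] varies by less than [1] contains [y N] and [y m] with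
    very different values of [1/h]; on the segment joining them [sin (1/h)] takes the values [1] and
    [-1]. *)
Lemma Cstar_embedded_pob : completely_regular_space X ->
  Cstar_embedded R (@P_beta R X) -> pseudo_omega_bounded X.
Proof.
move=> crX CY; apply: contrapT => /(vanishing_function R crX).
move=> [x0 [h [ch h0 hn]]].
have chY : continuous (fun y : Y => h (set_val y)).
  move=> y; apply: (@continuous_comp _ _ _ set_val h); last exact: ch.
  exact: set_val_continuous.
have cVY : continuous (fun y : Y => (h (set_val y))^-1).
  by apply: ctsV => // y; exact: lt0r_neq0.
have [||g cg gf] := CY (fun y : Y => sin (h (set_val y))^-1).
- move=> y; apply: (@continuous_comp _ _ _ (fun y : Y => (h (set_val y))^-1) sin).
    exact: cVY.
  exact: continuous_sin.
- by apply/bounded_fun_le; exists 1 => y; rewrite ler_norml sin_geN1 sin_le1.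
have [y Hy] := choice hn; have [U [UU UN]] := nat_ultra.
have [|mu _ ymu] := @compact_ultra_cvg nat U P _ (fun n => set_val (y n)) UU
    (concentrated_compact (@stone_cech_hausdorff R X) (@stone_cech_compact R X)
      (@closedT bX)).
  by apply: filterE => n /=; exact: probability_setT.
have : nbhs mu [set nu | `|g mu - g nu| < 1].
  by have /cvgrPdist_lt := cg mu; apply.
move=> /rp_nbhsP [I [f [e [e0 cf fg]]]].
have UE : U [set n | forall i, `|pb_integral (f i) (y n) - rp_integral (f i) mu| < e].
  apply: filter_forall => i.
  have : nbhs mu [set nu | `|rp_integral (f i) nu - rp_integral (f i) mu| < e].
    have /cvgrPdist_lt /(_ _ e0) := rp_integral_continuous (cf i) (x := mu).
    by apply: filterS => nu; rewrite distrC.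
  by move=> /ymu.
have [N HN] := filter_ex UE.
pose A := (h (set_val (y N)))^-1.
pose k := (Num.truncn A).+1.
(* The sine is [1] at [B] and [-1] at [B + pi]; both points lie beyond [A], and [m] is chosen with
   [1/h] beyond [B + pi]. *)
pose B : R := pi / 2 + (pi *+ 2) *+ k.
have pi2 : 2 <= pi :> R := pi_ge2 R.
have AB : A < B.
  apply: (lt_trans (truncnS_gt A)); rewrite -/k /B -mulr_natr.
  have : (k%:R : R) <= pi *+ 2 * k%:R by rewrite ler_peMl// mulr2n; lra.
  lra.
have BB : B < B + pi by lra.
have [m [/= Hm Mm]] := filter_ex (filterI UE (UN (Num.truncn (B + pi)))).
have hm : B + pi < (h (set_val (y m)))^-1.
  have : (m.+1%:R : R) <= (h (set_val (y m)))^-1.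
    by rewrite -[leLHS]invrK lef_pV2 ?posrE ?invr_gt0 ?ltr0n.
  apply: lt_le_trans; apply: (lt_le_trans (truncnS_gt _)).
  by rewrite ler_nat.
(* Clipping the parameter makes the segment a path that is continuous on the whole real line. *)
pose c (t : R) := Num.max 0 (Num.min 1 t).
have c01 t : 0 <= c t <= 1 by rewrite /c le_max lexx ge_max ler01 ge_min lexx.
have cc : continuous c.
  apply: cts_max; first exact: ctsC.
  by apply: cts_min; [exact: ctsC|move=> t; exact: cvg_id].
pose p t := mixture x0 (c t) (y m) (y N).
have cp : continuous p.
  by apply: mixture_continuous => // s; exact: cvg_cst.
pose H t := (h (set_val (p t)))^-1.
have cH : continuous H.
  move=> t; apply: (@continuous_comp _ _ _ p (fun y : Y => (h (set_val y))^-1)).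
    exact: cp.
  exact: cVY.
have H0 : H 0 = A.
  apply: (eq_pb_integral cVY) => f' cf'; rewrite mixtureE//.
  by rewrite /c (min_idPr _) ?ler01// maxxx mul0r add0r subr0 mul1r.
have H1 : H 1 = (h (set_val (y m)))^-1.
  apply: (eq_pb_integral cVY) => f' cf'; rewrite mixtureE//.
  by rewrite /c minxx (max_idPr _) ?ler01// mul1r subrr mul0r addr0.
have near t : `|g mu - sin (H t)| < 1.
  rewrite -gf; apply: fg => i.
  rewrite -[rp_integral _ (set_val _)]/(pb_integral (f i) (p t)) mixtureE//.
  exact: convex_dist_lt.
have hit v : A <= v -> v <= H 1 -> `|g mu - sin v| < 1.
  move=> Av vH; have [||t _ <-] := @IVT R H 0 1 v ler01; last exact: near.
    exact: continuous_subspaceT.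
  by rewrite H0 (min_idPl _) ?(max_idPr _) ?Av//; apply: le_trans vH.
have := hit B; rewrite /B sin_peak => /(_ (ltW AB)).
have := hit (B + pi); rewrite sinDpi sin_peak H1.
move=> /(_ (ltW (lt_trans AB BB)) (ltW hm)) a1 /(_ (ltW (lt_trans BB hm))).
move: a1; rewrite !ltr_norml => /andP[? ?] /andP[? ?]; lra.
Qed.

End CstarEmbedded.

(** * Extension of continuous functions *)

Lemma dist_perturb (R : realType) (a b c c' r s : R) :
  `|a - c| < r -> `|b - c'| < r -> s < `|c - c'| -> s - (r + r) < `|a - b|.
Proof.
move=> ac bc sc; have := ler_distD a c c'; have := ler_distD b a c'.
by rewrite (distrC c a); lra.
Qed.

Lemma nbhs_dist_lt (R : realType) (S : topologicalType) (f : S -> R) (y : S) e :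
  continuous f -> 0 < e -> nbhs y [set u | `|f u - f y| < e].
Proof.
move=> cf e0; have /cvgrPdist_lt /(_ _ e0) := cf y.
by apply: filterS => u; rewrite distrC.
Qed.

Section Extension.
Variables (R : realType) (X : topologicalType) (x0 : X).
Local Notation bX := (stone_cech R X).
Local Notation emb := (@sc_embed R X).
Local Notation P := (radon_probability R bX).
Local Notation Y := (set_type (@P_beta R X)).
Local Notation I01 := (set_type (`[0, 1]%classic : set R)).
Let cB : compact [set: bX] := @stone_cech_compact R X.

(** [rho] carries the other atoms with weights divided by [1 - w i]. It does not depend on [z' i],
    so moving one atom becomes a move in a mixture with fixed [t] and [rho]. *)
Lemma atomic_split (I : finType) (w : I -> R) (z : I -> X) (i : I) : weights w ->
  exists rho : Y, 0 <= w i <= 1 /\ forall z' : I -> X,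
    (forall j, j != i -> z' j = z j) -> forall h : bX -> R, continuous h ->
    pb_integral h (atomic x0 w z') = pb_integral h (mixture x0 (w i) (dirac_at R x0 (z' i)) rho).
Proof.
move=> ww; have [w0 w1] := ww.
have wi1 : w i + \sum_(j | j != i) w j = 1 by rewrite -w1 [RHS](bigD1 i).
have sw0 : 0 <= \sum_(j | j != i) w j by apply: sumr_ge0 => j _; exact: w0.
have wi : 0 <= w i <= 1 by rewrite w0/=; lra.
pose v j := if j == i then 0 else w j / (1 - w i).
have [wi_1|wi_1] := eqVneq (w i) 1.
  exists (atomic x0 w z); split => // z' zz' h ch.
  rewrite mixtureE// dirac_atE// atomicE// (bigD1 i)//= wi_1 subrr mul0r addr0.
  rewrite big1 ?addr0// => j ji.
  have /psumr_eq0P H : \sum_(j | j != i) w j = 0 by move: wi1; rewrite wi_1; lra.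
  by rewrite H ?mul0r.
have wi1' : 1 - w i != 0 by rewrite subr_eq0 eq_sym.
have vw : weights v.
  split; first by move=> j; rewrite /v; case: eqP => // _;
    rewrite divr_ge0 ?subr_ge0//; case/andP: wi.
  rewrite (bigD1 i)//= /v eqxx add0r.
  rewrite (eq_bigr (fun j => w j / (1 - w i))); last by move=> j /negbTE ->.
  rewrite -mulr_suml -wi1 addrAC subrr add0r divff//.
  by rewrite -[X in X != 0](addKr (w i)) wi1 addrC.
exists (atomic x0 v z); split => // z' zz' h ch.
rewrite mixtureE// dirac_atE// !atomicE// (bigD1 i)//=; congr (_ + _).
rewrite [in RHS](bigD1 i)//= /v eqxx mul0r add0r mulr_sumr.
apply: eq_bigr => j ji; rewrite (negbTE ji) zz'//.
by field.
Qed.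

(** * The pseudometric of exchanging one atom *)

Section SwapDistance.
Variables (f : Y -> R) (M : R).
Hypotheses (pX : pseudo_omega_bounded X) (cf : continuous f)
  (fM : forall y, `|f y| <= M).

Let F (x : X) (p : I01 * Y) : R :=
  f (mixture x0 (set_val p.1) (dirac_at R x0 x) p.2).

Definition swap_dist (x x' : X) : R :=
  sup (range (fun p : I01 * Y => `|F x p - F x' p|)).
Local Notation d := swap_dist.

Lemma I01_mem (t : R) : 0 <= t <= 1 -> t \in (`[0, 1]%classic : set R).
Proof. by move=> t01; apply/mem_set; rewrite /= in_itv. Qed.

Let bound x x' : has_ubound (range (fun p : I01 * Y => `|F x p - F x' p|)).
Proof.
exists (M + M) => _ [p _ <-]; apply: (le_trans (ler_normB _ _)).
by apply: lerD; exact: fM.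
Qed.

Lemma le_swap_dist x x' p : `|F x p - F x' p| <= d x x'.
Proof. by apply: ub_le_sup => //; exists p. Qed.

Lemma swap_dist_le x x' c : (forall p, `|F x p - F x' p| <= c) -> d x x' <= c.
Proof.
move=> H; apply: ge_sup => [|_ [p _ <-]//].
have m0 : (0 : R) \in (`[0, 1]%classic : set R) by apply: I01_mem; rewrite lexx ler01.
by eexists; exists (SigSub m0, dirac_at R x0 x0).
Qed.

Lemma swap_dist_ge0 x x' : 0 <= d x x'.
Proof.
have m0 : (0 : R) \in (`[0, 1]%classic : set R) by apply: I01_mem; rewrite lexx ler01.
exact: le_trans (le_swap_dist x x' (SigSub m0, dirac_at R x0 x0)).
Qed.

Lemma swap_dist0 x : d x x = 0.
Proof.
apply/eqP; rewrite eq_le swap_dist_ge0 andbT; apply: swap_dist_le => p.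
by rewrite subrr normr0.
Qed.

Lemma swap_distC x y : d x y = d y x.
Proof.
have H a b : d a b <= d b a.
  by apply: swap_dist_le => p; rewrite distrC; exact: le_swap_dist.
by apply/eqP; rewrite eq_le; apply/andP; split; exact: H.
Qed.

Lemma swap_dist_triangle x y z : d x z <= d x y + d y z.
Proof.
apply: swap_dist_le => p; apply: (le_trans (ler_distD (F y p) _ _)).
by apply: lerD; exact: le_swap_dist.
Qed.

(** The difference [F z p - F x p] is continuous in [z] and [p] and vanishes at [z = x];
    equicontinuity applies because the parameter space of pairs [p] is pseudo-omega-bounded too. *)
Lemma swap_dist_near x e : 0 < e -> nbhs x [set z | d z x < e].
Proof.
move=> e0; have e2 : 0 < e / 2 by rewrite divr_gt0.
have cF : continuous (fun q : X * (I01 * Y) => F q.1 q.2 - F x q.2).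
  have ct : continuous (fun q : X * (I01 * Y) => set_val q.2.1 : R).
    move=> q; apply: (@continuous_comp _ _ _ (fun q : X * (I01 * Y) => q.2.1) set_val).
      apply: (@continuous_comp _ _ _ snd fst); [exact: cvg_snd|exact: cvg_fst].
    exact: set_val_continuous.
  have cr : continuous (fun q : X * (I01 * Y) => q.2.2).
    by move=> q; apply: (@continuous_comp _ _ _ snd snd); exact: cvg_snd.
  have cmix (g : X * (I01 * Y) -> X) : continuous g ->
      continuous (fun q => mixture x0 (set_val q.2.1) (dirac_at R x0 (g q)) q.2.2).
    move=> cg; apply: mixture_continuous => //; last by move=> q; exact: I01P.
    move=> q; apply: (@continuous_comp _ _ _ g (fun x => dirac_at R x0 x)).
      exact: cg.
    exact: dirac_at_continuous.
  have cfm (g : X * (I01 * Y) -> X) : continuous g ->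
      continuous (fun q => F (g q) q.2).
    move=> cg q; apply: (@continuous_comp _ _ _
      (fun q => mixture x0 (set_val q.2.1) (dirac_at R x0 (g q)) q.2.2) f).
      exact: cmix.
    exact: cf.
  apply: ctsB; first by apply: cfm => q; exact: cvg_fst.
  by apply: cfm => q; exact: cvg_cst.
have pT : pseudo_omega_bounded (I01 * Y)%type.
  by apply: pob_prod; [exact: I01_pob|exact: pob_P_beta x0 pX].
have := @pob_equicontinuous R X (I01 * Y)%type _ x pX pT cF _ (e / 2) e2.
move=> /(_ (fun p => subrr _)); apply: filterS => z Hz /=.
by apply: (@le_lt_trans _ _ (e / 2)); [exact: swap_dist_le|lra].
Qed.

End SwapDistance.

(** * Uniform continuity under small moves of all atoms *)

Section Modulus.
Variables (f : Y -> R) (cf : continuous f) (d : X -> X -> R).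
Hypotheses (pX : pseudo_omega_bounded X)
  (dF : forall x x' t rho, 0 <= t <= 1 ->
    `|f (mixture x0 t (dirac_at R x0 x) rho) - f (mixture x0 t (dirac_at R x0 x') rho)|
      <= d x x')
  (d0 : forall x, d x x = 0) (dsym : forall x y, d x y = d y x)
  (dtri : forall x y z, d x z <= d x y + d y z)
  (dnear : forall x e, 0 < e -> nbhs x [set z | d z x < e]).

Lemma dist_ge0 x y : 0 <= d x y.
Proof. by have := dtri x y x; rewrite d0 (dsym y x); lra. Qed.

Lemma dist0_atomic1 (I : finType) (w : I -> R) (z z' : I -> X) (i : I) :
  weights w -> (forall j, j != i -> z' j = z j) -> d (z i) (z' i) = 0 ->
  f (atomic x0 w z) = f (atomic x0 w z').
Proof.
move=> ww zz' di; have [rho [wi H]] := atomic_split z i ww.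
have e1 : f (atomic x0 w z) = f (mixture x0 (w i) (dirac_at R x0 (z i)) rho).
  by apply: eq_pb_integral => //; exact: H.
have e2 : f (atomic x0 w z') = f (mixture x0 (w i) (dirac_at R x0 (z' i)) rho).
  by apply: eq_pb_integral => //; exact: H.
have := dF (z i) (z' i) rho wi.
by rewrite di normr_le0 subr_eq0 e1 e2 => /eqP.
Qed.

Lemma dist0_atomic (I : finType) (w : I -> R) (z z' : I -> X) : weights w ->
  (forall i, d (z i) (z' i) = 0) -> f (atomic x0 w z) = f (atomic x0 w z').
Proof.
(* In [c s] the atoms listed in [s] have already been exchanged; the induction adds one index at a
   time, possibly a repeated one. *)
move=> ww dz; pose c (s : seq I) i := if i \in s then z' i else z i.
have H (s : seq I) : f (atomic x0 w z) = f (atomic x0 w (c s)).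
  elim: s => [//|i s ->].
  apply: (@dist0_atomic1 _ w _ _ i ww) => [j ji|].
    by rewrite /c inE (negbTE ji).
  rewrite /c inE eqxx /=; case: ifP => _; [exact: d0|exact: dz].
rewrite (H (enum I)); congr (f (atomic x0 w _)).
by apply/funext => i; rewrite /c mem_enum.
Qed.

(* On a compact set pairs at small [d]-distance are weakly close to pairs at
   distance [0], whose exchange leaves [f] unchanged. *)
Lemma dist0_approx (K : set X) (I J : finType) (g : I -> X -> R)
    (h : J -> X -> R) (e : R) : compact K -> 0 < e ->
  (forall i, continuous (g i)) -> (forall j, continuous (h j)) ->
  exists2 a : R, 0 < a & forall z z', K z -> K z' -> d z z' < a ->
    exists cc : X * X, [/\ d cc.1 cc.2 = 0,
      forall i, `|g i cc.1 - g i z| < e & forall j, `|h j cc.2 - h j z'| < e].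
Proof.
move=> cK e0 cg ch; apply: contrapT => na.
have bad n : exists zz : X * X, [/\ K zz.1, K zz.2, d zz.1 zz.2 < n.+1%:R^-1 &
    ~ exists cc : X * X, [/\ d cc.1 cc.2 = 0,
      forall i, `|g i cc.1 - g i zz.1| < e & forall j, `|h j cc.2 - h j zz.2| < e]].
  apply: contrapT => nb; apply: na; exists n.+1%:R^-1; first by rewrite invr_gt0.
  move=> z z' Kz Kz' dz; apply: contrapT => nc; apply: nb.
  by exists (z, z').
have [q Hq] := choice bad; have [U [UU UN]] := nat_ultra.
have [|c _ qc] := @compact_ultra_cvg nat U X K (fun n => (q n).1) UU cK.
  by apply: filterE => n; case: (Hq n).
have [|c' _ qc'] := @compact_ultra_cvg nat U X K (fun n => (q n).2) UU cK.
  by apply: filterE => n; case: (Hq n).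
have near (L : finType) (k : L -> X -> R) u (v : nat -> X) :
    (forall l, continuous (k l)) -> v @ U --> u ->
    U [set n | forall l, `|k l u - k l (v n)| < e].
  move=> ck vu; apply: filter_forall => l.
  have /cvgrPdist_lt /(_ _ e0) := ck l u.
  by move=> /vu.
have cc0 : d c c' = 0.
  apply/eqP; rewrite eq_le dist_ge0 andbT.
  apply/ler_addgt0Pr => a; move: (a : R) => {}a a0; rewrite add0r.
  have a3 : 0 < a / 3 by rewrite divr_gt0.
  have U1 : U [set n | d (q n).1 c < a / 3] by exact: (qc _ (dnear c a3)).
  have U2 : U [set n | d (q n).2 c' < a / 3] by exact: (qc' _ (dnear c' a3)).
  have [n [/= [n1 n2] nN]] :=
    filter_ex (filterI (filterI U1 U2) (UN (Num.truncn (a / 3)^-1))).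
  have [_ _ n3 _] := Hq n.
  have n4 : n.+1%:R^-1 <= a / 3.
    rewrite invf_ple ?posrE ?ltr0n//; apply: (le_trans (ltW (truncnS_gt _))).
    by rewrite ler_nat.
  have := lt_le_trans n3 n4.
  have := dtri c (q n).1 c'; have := dtri (q n).1 (q n).2 c'.
  rewrite (dsym c (q n).1); lra.
have [n [/= n1 n2]] := filter_ex (filterI (near _ _ _ _ cg qc) (near _ _ _ _ ch qc')).
by case: (Hq n) => _ _ _; apply; exists (c, c').
Qed.

(** Counterexamples with distances below [1/(n+1)] are moved into one compact [K], keeping a gap of
    [e / 2], and converge along an ultrafilter to [mu] and [nu] with a gap of [e / 4]. Replacing
    close pairs of atoms by pairs at distance [0] then gives measures near [mu] and [nu] on which
    [f] agrees. *)
Lemma atomic_uniform (e : R) : 0 < e ->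
  exists2 a : R, 0 < a & forall (I : finType) (w : I -> R) (x x' : I -> X),
    weights w -> (forall i, d (x i) (x' i) < a) ->
    `|f (atomic x0 w x) - f (atomic x0 w x')| <= e.
Proof.
move=> e0; apply: contrapT => na.
have bad n : exists r : {I : finType & ((I -> R) * ((I -> X) * (I -> X)))%type},
    let w := (projT2 r).1 in let x := (projT2 r).2.1 in
    let x' := (projT2 r).2.2 in
    [/\ weights w, forall i, d (x i) (x' i) < n.+1%:R^-1 &
      e < `|f (atomic x0 w x) - f (atomic x0 w x')|].
  apply: contrapT => nb; apply: na; exists n.+1%:R^-1; first by rewrite invr_gt0.
  move=> I w x x' ww dx; rewrite leNgt; apply/negP => exx; apply: nb.
  by exists (existT _ I (w, (x, x'))).
have [r Hr] := choice bad.
pose I n := projT1 (r n); pose w n : I n -> R := (projT2 (r n)).1.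
pose x n : I n -> X := (projT2 (r n)).2.1.
pose x' n : I n -> X := (projT2 (r n)).2.2.
have ww n : weights (w n) by case: (Hr n).
have dx n i : d (x n i) (x' n i) < n.+1%:R^-1 by case: (Hr n) => _ + _; exact.
have ex n : e < `|f (atomic x0 (w n) (x n)) - f (atomic x0 (w n) (x' n))|.
  by case: (Hr n).
have e4 : 0 < e / 4 by rewrite divr_gt0.
have pert n (u : I n -> X) : exists V : I n -> set X,
    (forall i, open (V i) /\ V i (u i)) /\ forall z, (forall i, V i (z i)) ->
    `|f (atomic x0 (w n) z) - f (atomic x0 (w n) u)| < e / 4.
  exact: (atomic_perturb (ww n) (@nbhs_dist_lt _ _ _ (atomic x0 (w n) u) _ cf e4)).
pose V n := sval (cid (pert n (x n))); pose V' n := sval (cid (pert n (x' n))).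
have VP n := svalP (cid (pert n (x n))).
have VP' n := svalP (cid (pert n (x' n))).
(* Half of the slack: both atoms of a pair may move by [s n i] and their distance stays below
   [1/(n+1)]. *)
pose s n i := (n.+1%:R^-1 - d (x n i) (x' n i)) / 2.
have s0 n i : 0 < s n i by rewrite divr_gt0// subr_gt0.
pose W (j : {n : nat & I n} + {n : nat & I n}) : set X := match j with
  | inl (existT n i) => V n i `&` [set z | d z (x n i) < s n i]
  | inr (existT n i) => V' n i `&` [set z | d z (x' n i) < s n i] end.
have [|K [cK WK]] := pob_countable (U := W) pX.
  move=> [] [n i] /=; split.
  - apply: openI; last exact: open_dball.
    by have [/(_ i) []] := VP n.
  - by exists (x n i); split => //=; [have [/(_ i) []] := VP n|rewrite d0].
  - apply: openI; last exact: open_dball.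
    by have [/(_ i) []] := VP' n.
  - by exists (x' n i); split => //=; [have [/(_ i) []] := VP' n|rewrite d0].
have [z Hz] := choice (fun j : {n : nat & I n} => WK (inl j)).
have [z' Hz'] := choice (fun j : {n : nat & I n} => WK (inr j)).
pose y n := atomic x0 (w n) (fun i => z (existT _ n i)).
pose y' n := atomic x0 (w n) (fun i => z' (existT _ n i)).
have fyy n : e / 2 < `|f (y n) - f (y' n)|.
  have h1 : `|f (y n) - f (atomic x0 (w n) (x n))| < e / 4.
    by apply: (VP n).2 => i; case: (Hz (existT _ n i)) => -[].
  have h2 : `|f (y' n) - f (atomic x0 (w n) (x' n))| < e / 4.
    by apply: (VP' n).2 => i; case: (Hz' (existT _ n i)) => -[].
  have -> : e / 2 = e - (e / 4 + e / 4) by field.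
  exact: dist_perturb (ex n).
have dzz n i : d (z (existT _ n i)) (z' (existT _ n i)) < n.+1%:R^-1.
  have [[_ /= h1] _] := Hz (existT _ n i).
  have [[_ /= h2] _] := Hz' (existT _ n i).
  have := dtri (z (existT _ n i)) (x n i) (z' (existT _ n i)).
  have := dtri (x n i) (x' n i) (z' (existT _ n i)).
  rewrite (dsym (x' n i)); move: h1 h2 (dx n i); rewrite /s.
  by move: (n.+1%:R^-1) => q; lra.
have [U [UU UN]] := nat_ultra.
have cPK := @compact_concentrated R X K cK.
have [|mu _ ymu] := compact_ultra_cvg (x := y) UU cPK.
  apply: filterE => n; apply: atomic_concentrated => // i.
  by case: (Hz (existT _ n i)).
have [|nu _ ynu] := compact_ultra_cvg (x := y') UU cPK.
  apply: filterE => n; apply: atomic_concentrated => // i.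
  by case: (Hz' (existT _ n i)).
have e8 : 0 < e / 8 by rewrite divr_gt0.
have nmu := @nbhs_dist_lt _ _ _ mu _ cf e8.
have nnu := @nbhs_dist_lt _ _ _ nu _ cf e8.
have fmn : e / 4 < `|f mu - f nu|.
  have u1 : U [set n | `|f (y n) - f mu| < e / 8] := ymu _ nmu.
  have u2 : U [set n | `|f (y' n) - f nu| < e / 8] := ynu _ nnu.
  have [n [/= h1 h2]] := filter_ex (filterI u1 u2).
  have -> : e / 4 = e / 2 - (e / 8 + e / 8) by field.
  by apply: dist_perturb (fyy n); rewrite distrC.
have [I1 [g [a1 [a10 cg gmu]]]] := P_beta_nbhsP nmu.
have [I2 [h [a2 [a20 ch hnu]]]] := P_beta_nbhsP nnu.
(* Half, as two errors add up: from the convergence of [y n] and [y' n], and from the replacement of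
   their atoms. *)
pose a := Num.min a1 a2 / 2.
have a0 : 0 < a by rewrite divr_gt0// lt_min a10.
have aa1 : a + a <= a1 by rewrite -splitr ge_min lexx.
have aa2 : a + a <= a2 by rewrite -splitr ge_min lexx orbT.
have [b b0 Hb] := dist0_approx cK a0 (fun i => cts_emb (cg i)) (fun j => cts_emb (ch j)).
have Umu : U [set n | forall i, `|pb_integral (g i) (y n) - pb_integral (g i) mu| < a].
  apply: filter_forall => i.
  exact: (ymu _ (@nbhs_dist_lt _ _ _ mu _ (pb_integral_continuous (cg i)) a0)).
have Unu : U [set n | forall i, `|pb_integral (h i) (y' n) - pb_integral (h i) nu| < a].
  apply: filter_forall => i.
  exact: (ynu _ (@nbhs_dist_lt _ _ _ nu _ (pb_integral_continuous (ch i)) a0)).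
have [n [[/= nm nn] nN]] := filter_ex (filterI (filterI Umu Unu) (UN (Num.truncn b^-1))).
have nb : n.+1%:R^-1 <= b.
  rewrite invf_ple ?posrE ?ltr0n//; apply: (le_trans (ltW (truncnS_gt _))).
  by rewrite ler_nat.
have Hc i := Hb (z (existT _ n i)) (z' (existT _ n i)) (Hz _).2 (Hz' _).2
  (lt_le_trans (dzz n i) nb).
have [c {}Hc] := choice Hc.
have f1 : `|f (atomic x0 (w n) (fun i => (c i).1)) - f mu| < e / 8.
  apply: gmu => i; apply: lt_le_trans aa1.
  apply: (le_lt_trans (ler_distD (pb_integral (g i) (y n)) _ _)).
  apply: ler_ltD; last exact: nm.
  apply: atomic_dist => // j; apply: ltW.
  by have [_ + _] := Hc j; apply.
have f2 : `|f (atomic x0 (w n) (fun i => (c i).2)) - f nu| < e / 8.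
  apply: hnu => i; apply: lt_le_trans aa2.
  apply: (le_lt_trans (ler_distD (pb_integral (h i) (y' n)) _ _)).
  apply: ler_ltD; last exact: nn.
  apply: atomic_dist => // j; apply: ltW.
  by have [_ _ +] := Hc j; apply.
have f12 : f (atomic x0 (w n) (fun i => (c i).1)) = f (atomic x0 (w n) (fun i => (c i).2)).
  by apply: dist0_atomic => // i; have [] := Hc i.
rewrite f12 in f1.
have := dist_perturb f1 f2 fmn; rewrite subrr normr0.
by have -> : e / 4 - (e / 8 + e / 8) = 0; [field|rewrite ltxx].
Qed.

End Modulus.

End Extension.

Lemma inv_nat_small (R : realType) (e : R) : 0 < e ->
  exists n, n.+1%:R^-1 <= e.
Proof.
move=> e0; exists (Num.truncn e^-1).
by rewrite invf_ple ?posrE ?ltr0n// ltW// truncnS_gt.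
Qed.

Lemma uniform_approx_continuous (R : realType) (S : topologicalType)
    (G : nat -> S -> R) (g : S -> R) : (forall n, continuous (G n)) ->
  (forall n z, `|g z - G n z| <= n.+1%:R^-1) -> continuous g.
Proof.
move=> cG gG z; apply/cvgrPdist_le => e; move: (e : R) => {}e ep.
have e3 : 0 < e / 3 by rewrite divr_gt0.
have [n ne] := inv_nat_small e3.
have := @nbhs_dist_lt R S (G n) z (e / 3) (cG n) e3.
apply: filterS => u /= Hu.
apply: (le_trans (ler_distD (G n z) _ _)).
have -> : e = e / 3 + (e / 3 + e / 3) by field.
apply: lerD; first exact: le_trans (gG n z) ne.
apply: (le_trans (ler_distD (G n u) _ _)); apply: lerD.
  by rewrite distrC ltW.
by rewrite distrC; exact: le_trans (gG n u) ne.
Qed.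

(** * Uniform approximation and extension to all Radon probabilities *)

Section CstarExtension.
Variables (R : realType) (X : topologicalType) (x0 : X).
Local Notation bX := (stone_cech R X).
Local Notation emb := (@sc_embed R X).
Local Notation P := (radon_probability R bX).
Local Notation Y := (set_type (@P_beta R X)).
Let cB : compact [set: bX] := @stone_cech_compact R X.

Lemma dense_le (g : P -> R) c : continuous g ->
  (forall y : Y, g (set_val y) <= c) -> forall z, g z <= c.
Proof.
move=> cg gc z; rewrite leNgt; apply/negP => gz.
have nz : nbhs z [set u | c < g u].
  by apply: open_nbhs_nbhs; split => //; exact: cts_open_gt.
have [I [w [x [_ /= H]]]] := atomic_dense x0 nz.
by move: H; rewrite ltNge gc.
Qed.

Lemma dense_eq (g h : bX -> R) : continuous g -> continuous h ->
  (forall x, g (emb x) = h (emb x)) -> forall z, g z = h z.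
Proof.
move=> cg ch gh z; apply/eqP; rewrite -subr_eq0 -normr_eq0 eq_le normr_ge0 andbT.
rewrite leNgt; apply/negP => gz.
have cgh : continuous (fun z => `|g z - h z|) by apply: cts_norm; exact: ctsB.
have nz : nbhs z [set u | 0 < `|g u - h u|].
  by apply: open_nbhs_nbhs; split => //; exact: cts_open_gt.
have [x /=] := sc_embed_dense nz.
by rewrite gh subrr normr0 ltxx.
Qed.

(** [G z] is [f] at the measure with atoms [b i] and weights the integrals of [g i], which makes
    sense for every [z]. By density the estimate is checked on atomic measures: each atom is divided
    according to [psi], and each piece moves to a point of the net by less than [a]. *)
Lemma approx_extension (f : Y -> R) (e : R) : pseudo_omega_bounded X ->
  continuous f -> bounded_fun f -> 0 < e ->
  exists2 G : P -> R, continuous G & forall y, `|f y - G (set_val y)| <= e.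
Proof.
move=> pX cf /bounded_fun_le [M fM] e0.
pose d := swap_dist x0 f.
have d0 : forall x, d x x = 0 := swap_dist0 x0 fM.
have dsym : forall x y, d x y = d y x := swap_distC x0 fM.
have dtri : forall x y z, d x z <= d x y + d y z := swap_dist_triangle x0 fM.
have dnear : forall x e, 0 < e -> nbhs x [set z | d z x < e] :=
  swap_dist_near x0 pX cf.
have dF x x' t rho : 0 <= t <= 1 ->
    `|f (mixture x0 t (dirac_at R x0 x) rho) - f (mixture x0 t (dirac_at R x0 x') rho)|
      <= d x x'.
  move=> t01; exact: (le_swap_dist x0 fM x x' (SigSub (I01_mem t01), rho)).
have [a a0 Ha] := atomic_uniform cf pX dF d0 dsym dtri dnear e0.
move: (d) d0 dsym dtri dnear Ha {dF} => {}d d0 dsym dtri dnear Ha.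
have [n [b Hb]] := pob_finite_net d0 dsym dtri dnear pX a0.
have [psi [cpsi psi0 psi1 psid]] := net_partition dsym dtri dnear Hb.
have psi01 i x : 0 <= psi i x <= 1.
  rewrite psi0/= -(psi1 x) (bigD1 i)//= lerDl.
  by apply: sumr_ge0 => j _; exact: psi0.
have [g Hg] := choice (fun i => sc_extend01 (cpsi i) (psi01 i)).
have cg i : continuous (g i) by case: (Hg i).
have sumg z : \sum_i g i z = 1.
  apply: (@dense_eq (fun z => \sum_i g i z) (fun=> 1)).
  - exact: cts_sum.
  - exact: ctsC.
  - by move=> x; rewrite -(psi1 x); apply: eq_bigr => i _; case: (Hg i).
pose W (z : P) i := rp_integral (g i) z.
have wW z : weights (W z).
  split=> [i|].
    apply: (state_ge0 (rp_state cB z)) => // u.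
    by case: (Hg i) => _ /(_ u) /andP[].
  rewrite -(state_sum (rp_state cB z))//.
  rewrite (_ : (fun _ => _) = fun=> 1); first exact: (state_cst (rp_state cB z)).
  by apply/funext => u; rewrite sumg.
pose q z := atomic x0 (W z) b.
have cq : continuous q.
  move=> z; apply: cvg_to_P_beta => h ch.
  rewrite (_ : (fun _ => _) = fun z => \sum_i W z i * h (emb (b i))); last first.
    by apply/funext => u; rewrite atomicE.
  rewrite atomicE//; apply: (cts_sum (F := fun i z => W z i * h (emb (b i)))) => i.
  by apply: ctsM; [exact: rp_integral_continuous|exact: ctsC].
have cG : continuous (f \o q).
  by move=> z; apply: (@continuous_comp _ _ _ q f); [exact: cq|exact: cf].
exists (f \o q) => // y.
have cD : continuous (fun y : Y => `|f y - (f \o q) (set_val y)|).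
  apply: cts_norm; apply: ctsB => // u.
  apply: (@continuous_comp _ _ _ set_val (f \o q)); last exact: cG.
  exact: set_val_continuous.
rewrite leNgt; apply/negP => ye.
have ny : nbhs y [set u : Y | e < `|f u - (f \o q) (set_val u)|].
  by apply: open_nbhs_nbhs; split => //; exact: cts_open_gt.
have [I [w [x [ww /=]]]] := atomic_dense_P_beta x0 ny.
rewrite ltNge => /negP; apply.
pose v (p : I * 'I_n) := w p.1 * psi p.2 (x p.1).
(* A piece of mass [0] stays in place, since its distance to [b p.2] is not controlled. *)
pose c (p : I * 'I_n) := if psi p.2 (x p.1) == 0 then x p.1 else b p.2.
have vw : weights v.
  split=> [p|]; first by apply: mulr_ge0; [case: ww|].
  rewrite -(pair_bigA _ (fun i j => w i * psi j (x i)))/=.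
  by case: ww => _ <-; apply: eq_bigr => i _; rewrite -mulr_sumr psi1 mulr1.
have e1 : f (atomic x0 w x) = f (atomic x0 v (fun p => x p.1)).
  apply: eq_pb_integral => // h ch; rewrite !atomicE//.
  rewrite -(pair_bigA _ (fun i j => w i * psi j (x i) * h (emb (x i))))/=.
  apply: eq_bigr => i _.
  by rewrite -mulr_suml -mulr_sumr psi1 mulr1.
have e2 : f (q (set_val (atomic x0 w x))) = f (atomic x0 v c).
  apply: eq_pb_integral => // h ch; rewrite !atomicE//.
  rewrite -(pair_bigA _ (fun i j => w i * psi j (x i) * h (emb (c (i, j)))))/=.
  rewrite exchange_big/=; apply: eq_bigr => j _.
  rewrite /W -/(pb_integral (g j) (atomic x0 w x)) atomicE// mulr_suml.
  apply: eq_bigr => i _; case: (Hg j) => _ _ ->.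
  by rewrite /c/=; case: eqP => // ->; rewrite mulr0 !mul0r.
rewrite e1 e2; apply: Ha => // p; rewrite /c.
by case: eqP => [_|/eqP pn]; [rewrite d0|exact: psid].
Qed.

(** The bounds [G m - 1/(m+1) <= G n + 1/(n+1)] hold on [Y], hence everywhere by density. So the
    supremum [g] of the lower bounds is within [1/(n+1)] of every [G n], and is their uniform
    limit. *)
Lemma Cstar_extension : pseudo_omega_bounded X -> Cstar_embedded R (@P_beta R X).
Proof.
move=> pX f cf bf.
have e0 n : 0 < n.+1%:R^-1 :> R by rewrite invr_gt0.
have H n : exists G : P -> R, continuous G /\
    forall y, `|f y - G (set_val y)| <= n.+1%:R^-1.
  by have [G cG fG] := approx_extension pX cf bf (e0 n); exists G.
have [G HG] := choice H.
have cG n : continuous (G n) by case: (HG n).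
have fG n y : `|f y - G n (set_val y)| <= n.+1%:R^-1 by case: (HG n).
have GG n m z : G m z - m.+1%:R^-1 <= G n z + n.+1%:R^-1.
  rewrite -subr_le0.
  apply: (@dense_le (fun z => G m z - m.+1%:R^-1 - (G n z + n.+1%:R^-1))).
    apply: ctsB; first by apply: ctsB => //; exact: ctsC.
    by apply: ctsD => //; exact: ctsC.
  move=> y; have := fG m y; have := fG n y.
  rewrite !ler_norml => /andP[h1 h2] /andP[h3 h4].
  by move: h1 h2 h3 h4; move: (n.+1%:R^-1) (m.+1%:R^-1) => a b; lra.
pose g z := sup (range (fun n => G n z - n.+1%:R^-1)).
have gub z : has_ubound (range (fun n => G n z - n.+1%:R^-1)).
  by exists (G 0%N z + 1%:R^-1) => _ [n _ <-]; exact: GG.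
have gG n z : `|g z - G n z| <= n.+1%:R^-1.
  rewrite ler_distl; apply/andP; split.
    by apply: ub_le_sup => //; exists n.
  apply: ge_sup; first by exists (G 0%N z - 1%:R^-1), 0%N.
  by move=> _ [m _ <-]; exact: GG.
exists g; first exact: (uniform_approx_continuous cG gG).
move=> y; apply/eqP; rewrite -subr_eq0 -normr_eq0 eq_le normr_ge0 andbT.
apply/ler_addgt0Pr => e; move: (e : R) => {}e ep; rewrite add0r.
have e2 : 0 < e / 2 by rewrite divr_gt0.
have [n ne] := inv_nat_small e2.
apply: (le_trans (ler_distD (G n (set_val y)) _ _)).
rewrite (splitr e); apply: lerD; first exact: le_trans (gG n _) ne.
by rewrite distrC; exact: le_trans (fG n y) ne.
Qed.

End CstarExtension.

Lemma radon_stone_cech_nonempty (R : realType) (X : topologicalType)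
  (mu : radon_probability R (stone_cech R X)) : exists x : X, True.
Proof. by have [x _] := sc_nonempty (rp_nonempty mu); exists x. Qed.

Theorem theorem1p27 (R : realType) (X : topologicalType)
    (tychX : tychonoff_space X) :
  [<-> pseudo_omega_bounded X;
       pseudocompact R (set_type (@P_beta R X));
       Cstar_embedded R (@P_beta R X);
       pseudo_omega_bounded (set_type (@P_beta R X))].
Proof.
have crX := tychX.1.
have pobY : pseudo_omega_bounded X ->
    pseudo_omega_bounded (set_type (@P_beta R X)).
  (* The nonempty set [U 0] yields a measure, and hence the base point of [X]. *)
  move=> pX U HU; have [_ [y _]] := HU 0%N.
  by have [x0 _] := radon_stone_cech_nonempty (set_val y); exact: (pob_P_beta x0 pX HU).
tfae.
- by move=> /pobY; exact: pob_pseudocompact.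
- move=> /(pseudocompact_P_beta_pob crX) pX f cf bf.
  have [[mu _]|nP] := pselect (exists mu : radon_probability R (stone_cech R X), True).
    by have [x0 _] := radon_stone_cech_nonempty mu; exact: (Cstar_extension x0 pX).
  (* Without any Radon probability [P_beta] is empty, and every continuous function is an
     extension. *)
  exists (fun=> 0); first exact: ctsC.
  by move=> y; exfalso; apply: nP; exists (set_val y).
- by move=> /(Cstar_embedded_pob crX) /pobY.
- by move=> /(@pob_pseudocompact R _) /(pseudocompact_P_beta_pob crX).
Qed.
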